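(* Let $G$ be a $\ast$expansive profinite group. Then there exists a subnormal series $$G\supseteq G_1\supseteq G_2\supseteq\ldots\supseteq G_n=1$$ of $\ast$expansive subgroups $G_i$ of $G$ such that $G/G_1$ is a finite group and $G_i/G_{i+1}$ is isomorphic to a full two-sided group shift on a finite simple group $\mathcal{G}_i$ for $i=1,\ldots,n-1$. Moreover, the length $n$ of such a series and the isomorphism classes of the finite simple groups $\mathcal{G}_i$ (up to a permutation of the indices) are uniquely determined by $G$.
   Context: An automorphism $\sigma\colon G\to G$ of a profinite group $G$ (as a topological group) is an expansive automorphism if there exists a neighborhood $U$ of $1$ such that $\bigcap_{n\in\mathbb{Z}}\sigma^n(U)=1$. A $\ast$expansive profinite group is a profinite group together with an expansive automorphism. A $\ast$expansive subgroup of $G$ is a closed subgroup $H$ with $\sigma(H)=H$. Subnormal series means: $G_1$ is normal in $G$ and $G_{i+1}$ is normal in $G_i$ for $i=1,\ldots,n-1$; here $n\geq 1$. Quotients carry the quotient topology and induced automorphism. The full two-sided group shift on a finite group $\mathcal{G}$ is the profinite group $\mathcal{G}^{\mathbb{Z}}$ (product topology, componentwise multiplication) with the automorphism $\sigma((g_n)_{n\in\mathbb{Z}})=(g_{n+1})_{n\in\mathbb{Z}}$. Isomorphisms are isomorphisms of topological groups commuting with $\sigma$. *)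

(* Defs.v *)
From HB Require Import structures.
From mathcomp Require Import all_boot ssralg ssrint fingroup perm morphism gseries.
From mathcomp Require Import generic_quotient.
From mathcomp Require Import all_classical topology.

Set Implicit Arguments.
Unset Strict Implicit.
Unset Printing Implicit Defensive.

Local Open Scope classical_set_scope.
Local Open Scope quotient_scope.
Local Open Scope group_scope.

(* [groupType] of MathComp (possibly infinite groups); [fingroup] shadows the
   short names [Group] and [group_closed], hence the [monoid] prefixes. *)
HB.mixin Record isTopologicalGroup G of Topological G & monoid.Group G := {
  mulg_continuous : continuous (fun x : G * G => x.1 * x.2) ;
  invg_continuous : continuous (fun x : G => x^-1)
}.

#[short(type="topGroupType")]
HB.structure Definition TopologicalGroup :=
  {G of Topological G & monoid.Group G & isTopologicalGroup G}.

(* The inverse is part of the data so that negative powers of [sigma] can be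
   written down; it is determined by [sigma]. *)
HB.mixin Record hasTopAutomorphism G of TopologicalGroup G := {
  sigma : G -> G ;
  sigmaV : G -> G ;
  sigmaM : {morph sigma : x y / x * y} ;
  sigmaK : cancel sigma sigmaV ;
  sigmaVK : cancel sigmaV sigma ;
  sigma_continuous : continuous sigma ;
  sigmaV_continuous : continuous sigmaV
}.

#[short(type="starGroupType")]
HB.structure Definition StarGroup :=
  {G of TopologicalGroup G & hasTopAutomorphism G}.

Definition profinite (G : topGroupType) : Prop :=
  [/\ compact [set: G], hausdorff_space G & totally_disconnected [set: G]].

Definition sigma_pow (G : starGroupType) (n : int) : G -> G :=
  match n with
  | Posz m => iter m sigma
  | Negz m => iter m.+1 sigmaV
  end.

Definition expansive (G : starGroupType) : Prop :=
  exists2 U : set G, nbhs 1 U & \bigcap_(n : int) (sigma_pow n @` U) = [set 1].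

Definition expansive_profinite (G : starGroupType) : Prop :=
  profinite G /\ expansive G.

Definition star_isomorphic (G H : starGroupType) : Prop :=
  exists (f : G -> H) (g : H -> G),
    [/\ {morph f : x y / x * y}, cancel f g /\ cancel g f,
        continuous f, continuous g & forall x, f (sigma x) = sigma (f x)].

(* Closed subgroups [H] with [sigma(H) = H]. *)
Record starSubgroup (G : starGroupType) := StarSubgroup {
  star_subset :> set G ;
  star_closed : closed star_subset ;
  star_group_closed : monoid.group_closed (mem star_subset) ;
  star_invariant : sigma @` star_subset = star_subset
}.

Arguments star_closed {G} s : rename.
Arguments star_group_closed {G} s : rename.
Arguments star_invariant {G} s : rename.

Section SubgroupAsGroup.
Variables (G : starGroupType) (H : starSubgroup G).

Definition subgroup_type : Type := set_type H.

HB.instance Definition _ := SubChoice.on subgroup_type.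
HB.instance Definition _ := Topological.on subgroup_type.
HB.instance Definition _ :=
  SubChoice_isSubGroup.Build G (mem (H : set G)) subgroup_type
    (star_group_closed H).

Lemma subgroup_val_continuous : continuous (val : subgroup_type -> G).
Proof. exact: initial_continuous. Qed.

Lemma continuous_subgroup (T : topologicalType) (f : T -> subgroup_type) :
  continuous (val \o f) -> continuous f.
Proof.
move=> /continuousP cf; apply/continuousP => _ [A oA <-].
exact: (cf _ oA).
Qed.

Lemma subgroup_mulg_continuous :
  continuous (fun x : subgroup_type * subgroup_type => x.1 * x.2).
Proof.
apply: continuous_subgroup => x /=.
have -> : val \o (fun x : subgroup_type * subgroup_type => x.1 * x.2) =
    (fun z : G * G => z.1 * z.2) \o (fun x => (val x.1, val x.2)).
  by apply/funext => y.
apply: continuous_comp; last exact: mulg_continuous.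
apply: cvg_pair => /=.
- apply: (continuous_comp _ (subgroup_val_continuous (x := _))).
  exact: cvg_fst.
- apply: (continuous_comp _ (subgroup_val_continuous (x := _))).
  exact: cvg_snd.
Qed.

Lemma subgroup_invg_continuous :
  continuous (fun x : subgroup_type => x^-1).
Proof.
apply: continuous_subgroup => x /=.
have -> : val \o (fun x : subgroup_type => x^-1) = (fun z : G => z^-1) \o val.
  by apply/funext => y.
apply: continuous_comp; first exact: subgroup_val_continuous.
exact: invg_continuous.
Qed.

HB.instance Definition _ := isTopologicalGroup.Build subgroup_type
  subgroup_mulg_continuous subgroup_invg_continuous.

Lemma mem_sigma (x : G) : x \in (H : set G) -> sigma x \in (H : set G).
Proof.
by move=> /set_mem Hx; apply/mem_set; rewrite -(star_invariant H); exists x.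
Qed.

Lemma mem_sigmaV (x : G) : x \in (H : set G) -> sigmaV x \in (H : set G).
Proof.
move=> /set_mem; rewrite -[X in X x](star_invariant H) => -[y Hy <-].
by rewrite sigmaK; apply/mem_set.
Qed.

Definition subgroup_sigma (x : subgroup_type) : subgroup_type :=
  Sub (sigma (val x)) (mem_sigma (valP x)).

Definition subgroup_sigmaV (x : subgroup_type) : subgroup_type :=
  Sub (sigmaV (val x)) (mem_sigmaV (valP x)).

Lemma subgroup_sigmaM : {morph subgroup_sigma : x y / x * y}.
Proof. by move=> x y; apply: val_inj; rewrite /= sigmaM. Qed.

Lemma subgroup_sigmaK : cancel subgroup_sigma subgroup_sigmaV.
Proof. by move=> x; apply: val_inj; rewrite /= sigmaK. Qed.

Lemma subgroup_sigmaVK : cancel subgroup_sigmaV subgroup_sigma.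
Proof. by move=> x; apply: val_inj; rewrite /= sigmaVK. Qed.

Lemma subgroup_sigma_continuous : continuous subgroup_sigma.
Proof.
apply: continuous_subgroup => x /=.
have -> : val \o subgroup_sigma = (sigma : G -> G) \o val by apply/funext.
apply: continuous_comp; first exact: subgroup_val_continuous.
exact: sigma_continuous.
Qed.

Lemma subgroup_sigmaV_continuous : continuous subgroup_sigmaV.
Proof.
apply: continuous_subgroup => x /=.
have -> : val \o subgroup_sigmaV = (sigmaV : G -> G) \o val by apply/funext.
apply: continuous_comp; first exact: subgroup_val_continuous.
exact: sigmaV_continuous.
Qed.

HB.instance Definition _ := hasTopAutomorphism.Build subgroup_type
  subgroup_sigmaM subgroup_sigmaK subgroup_sigmaVK
  subgroup_sigma_continuous subgroup_sigmaV_continuous.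

End SubgroupAsGroup.

(* [K :&: H] as a subgroup of the group [subgroup_type H]; it is used only for
   [K `<=` H]. *)
Section RelativeSubgroup.
Variables (G : starGroupType) (H K : starSubgroup G).

Definition relative_set : set (subgroup_type H) :=
  [set x | (K : set G) (val x)].

Lemma relative_closed : closed relative_set.
Proof.
have cv := @subgroup_val_continuous G H.
exact: (@preimage_closed _ _ (val : subgroup_type H -> G) _
  (fun x _ => cv x) (star_closed K)).
Qed.

Lemma relative_group_closed : monoid.group_closed (mem relative_set).
Proof.
have [K1 KF] := star_group_closed K.
split; first by apply/mem_set/set_mem.
move=> x y /set_mem Kx /set_mem Ky; apply/mem_set.
by apply/set_mem; apply: KF; apply/mem_set.
Qed.

Lemma relative_invariant : sigma @` relative_set = relative_set.
Proof.
apply/seteqP; split=> [_ [x Kx <-]|x Kx].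
  by rewrite /relative_set /= -[X in X _](star_invariant K); exists (val x).
exists (sigmaV x); last exact: sigmaVK.
by apply/set_mem/mem_sigmaV/mem_set.
Qed.

Definition relative_subgroup : starSubgroup (subgroup_type H) :=
  StarSubgroup relative_closed relative_group_closed relative_invariant.

End RelativeSubgroup.

Definition normal_subgroup (G : starGroupType) (N : starSubgroup G) : Prop :=
  forall x y : G, (N : set G) x -> (N : set G) (x ^ y).

(* [G / N] is the type of classes of [x ~ y <-> x^-1 * y \in N], with the
   quotient topology, the induced group law and the induced automorphism. *)
Section QuotientGroup.
Variables (G : starGroupType) (N : starSubgroup G) (nN : normal_subgroup N).

Definition coset_rel : rel G := fun x y => x^-1 * y \in (N : set G).

Let N1 : (N : set G) 1.
Proof. by have [/set_mem] := star_group_closed N. Qed.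

Let NM x y : (N : set G) x -> (N : set G) y -> (N : set G) (x * y).
Proof.
move=> Nx Ny; apply/set_mem.
by apply: (group_closedM (star_group_closed N)); apply/mem_set.
Qed.

Let NV x : (N : set G) x -> (N : set G) x^-1.
Proof.
move=> Nx; apply/set_mem.
by apply: (group_closedV (star_group_closed N)); apply/mem_set.
Qed.

Lemma coset_relP x y : reflect ((N : set G) (x^-1 * y)) (coset_rel x y).
Proof. by apply: (iffP idP) => [/set_mem|/mem_set]. Qed.

Lemma coset_rel_refl : reflexive coset_rel.
Proof. by move=> x; apply/coset_relP; rewrite mulVg. Qed.

Lemma coset_rel_sym : symmetric coset_rel.
Proof.
have sub x y : coset_rel x y -> coset_rel y x.
  by move=> /coset_relP/NV; rewrite invgM invgK => /coset_relP.
by move=> x y; apply/idP/idP; apply: sub.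
Qed.

Lemma coset_rel_trans : transitive coset_rel.
Proof.
move=> y x z /coset_relP xy /coset_relP yz; apply/coset_relP.
by have := NM xy yz; rewrite mulgA mulgK.
Qed.

Canonical coset_equiv :=
  EquivRel coset_rel coset_rel_refl coset_rel_sym coset_rel_trans.

Definition quotient_group (_ : normal_subgroup N) : Type :=
  quotient_topology {eq_quot coset_equiv}.

Local Notation Q := (quotient_group nN).

HB.instance Definition _ := Topological.on Q.
HB.instance Definition _ := Quotient.on Q.

Lemma cosetP (x y : G) : reflect (\pi_Q x = \pi_Q y) (coset_rel x y).
Proof. exact: (@eqmodP _ coset_equiv x y). Qed.

Lemma quo_ind (P : Q -> Prop) : (forall x, P (\pi_Q x)) -> forall x, P x.
Proof. by move=> Ppi x; rewrite -[x]reprK. Qed.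

Definition quo_one : Q := \pi_Q 1.
Definition quo_inv (x : Q) : Q := \pi_Q (repr x)^-1.
Definition quo_mul (x y : Q) : Q := \pi_Q (repr x * repr y).

Let repr_coset x : (N : set G) ((repr (\pi_Q x))^-1 * x).
Proof. by apply/coset_relP/cosetP; rewrite reprK. Qed.

Lemma quo_mulE x y : quo_mul (\pi_Q x) (\pi_Q y) = \pi_Q (x * y).
Proof.
apply/cosetP/coset_relP.
have := NM (nN (repr (\pi_Q y)) (repr_coset x)) (repr_coset y).
by rewrite conjgE invgM !mulgA mulgK.
Qed.

Lemma quo_invE x : quo_inv (\pi_Q x) = \pi_Q x^-1.
Proof.
apply/cosetP/coset_relP.
by have := NV (nN (repr (\pi_Q x))^-1 (repr_coset x));
  rewrite conjgE invgK !mulgA mulgV mul1g invgM invgK.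
Qed.

Lemma quo_mulA : associative quo_mul.
Proof.
elim/quo_ind=> x; elim/quo_ind=> y; elim/quo_ind=> z.
by rewrite (quo_mulE y z) (quo_mulE x y) 2!quo_mulE mulgA.
Qed.

Lemma quo_mul1 : left_id quo_one quo_mul.
Proof. by elim/quo_ind=> x; rewrite quo_mulE mul1g. Qed.

Lemma quo_mulr1 : right_id quo_one quo_mul.
Proof. by elim/quo_ind=> x; rewrite quo_mulE mulg1. Qed.

Lemma quo_mulV : left_inverse quo_one quo_inv quo_mul.
Proof. by elim/quo_ind=> x; rewrite quo_invE quo_mulE mulVg. Qed.

Lemma quo_mulrV : right_inverse quo_one quo_inv quo_mul.
Proof. by elim/quo_ind=> x; rewrite quo_invE quo_mulE mulgV. Qed.

HB.instance Definition _ := isGroup.Build Q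
  quo_mulA quo_mul1 quo_mulr1 quo_mulV quo_mulrV.

Lemma quo_piM (x y : G) : \pi_Q (x * y) = \pi_Q x * \pi_Q y :> Q.
Proof. by apply/esym/quo_mulE. Qed.

Lemma quo_pi_continuous : continuous (\pi_Q : G -> Q).
Proof. exact: pi_continuous. Qed.

Lemma quo_continuous (T : topologicalType) (f : Q -> T) :
  continuous (fun x : G => f (\pi_Q x)) -> continuous f.
Proof. by move=> cf; apply/quotient_continuous. Qed.

Lemma quo_pi_nbhs (x : G) (A : set G) :
  nbhs x A -> nbhs (\pi_Q x) ((\pi_Q : G -> Q) @` A).
Proof.
rewrite nbhsE => -[U [oU Ux] UA].
apply: filterS (image_subset (\pi_Q : G -> Q) UA) _.
apply: open_nbhs_nbhs; split; last by exists x.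
rewrite /open /= /quotient_open.
have -> : (\pi_Q : G -> Q) @^-1` ((\pi_Q : G -> Q) @` U) =
    \bigcup_(n in (N : set G)) (fun y : G => y * n) @^-1` U.
  apply/seteqP; split=> y /=.
    move=> [u Uu /cosetP/coset_relP Nuy]; exists (u^-1 * y)^-1; first exact: NV.
    by rewrite /= invgM invgK mulVKg.
  move=> [n Nn Uyn]; exists (y * n) => //.
  apply/cosetP/coset_relP; rewrite invgM mulgVK; exact: NV.
apply: bigcup_open => n _.
have cn : continuous (fun y : G => y * n).
  move=> y; apply: (@continuous_comp _ _ _ (fun y => (y, n))
    (fun z : G * G => z.1 * z.2)); last exact: mulg_continuous.
  by apply: cvg_pair => /=; [exact: cvg_id|exact: cvg_cst].
by move/continuousP: cn; apply.
Qed.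

Lemma quo_mulg_continuous : continuous (fun x : Q * Q => x.1 * x.2).
Proof.
move=> [a b] W /=; rewrite -[a]reprK -[b]reprK.
set x := repr a; set y := repr b.
rewrite [X in nbhs X W]quo_mulE => /(quo_pi_continuous (x := _)) /=.
rewrite /nbhs /= => /(@mulg_continuous G (x, y)) [[A B] /= [Ax By] AB].
exists ((\pi_Q : G -> Q) @` A, (\pi_Q : G -> Q) @` B).
  by split; apply: quo_pi_nbhs.
move=> [_ _] /= [[u Au <-] [v Bv <-]].
by rewrite [X in W X]quo_mulE; exact: (AB (u, v)).
Qed.

Lemma quo_invg_continuous : continuous (fun x : Q => x^-1).
Proof.
apply: quo_continuous => x.
have -> : (fun x : G => (\pi_Q x : Q)^-1) = \pi_Q \o (fun x : G => x^-1).
  by apply/funext => y; exact: quo_invE.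
apply: continuous_comp; first exact: invg_continuous.
exact: quo_pi_continuous.
Qed.

HB.instance Definition _ := isTopologicalGroup.Build Q
  quo_mulg_continuous quo_invg_continuous.

Definition quo_sigma (x : Q) : Q := \pi_Q (sigma (repr x)).
Definition quo_sigmaV (x : Q) : Q := \pi_Q (sigmaV (repr x)).

Let sigmaV_morph : {morph (@sigmaV G) : x y / x * y}.
Proof. by move=> x y; apply: (can_inj sigmaK); rewrite sigmaM !sigmaVK. Qed.

Let morphVM (f : G -> G) (fM : {morph f : x y / x * y}) x y :
  f (x^-1 * y) = (f x)^-1 * f y.
Proof. by apply: (mulgI (f x)); rewrite -fM !mulVKg. Qed.

Lemma quo_sigmaE x : quo_sigma (\pi_Q x) = \pi_Q (sigma x).
Proof.
apply/cosetP; rewrite /coset_rel -morphVM; last exact: sigmaM.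
by apply/mem_sigma/mem_set.
Qed.

Lemma quo_sigmaVE x : quo_sigmaV (\pi_Q x) = \pi_Q (sigmaV x).
Proof.
apply/cosetP; rewrite /coset_rel -morphVM; last exact: sigmaV_morph.
by apply/mem_sigmaV/mem_set.
Qed.

Lemma quo_sigmaM : {morph quo_sigma : x y / x * y}.
Proof.
elim/quo_ind=> x; elim/quo_ind=> y; rewrite -quo_piM.
by rewrite (quo_sigmaE (x * y)) (quo_sigmaE x) (quo_sigmaE y) sigmaM quo_piM.
Qed.

Lemma quo_sigmaK : cancel quo_sigma quo_sigmaV.
Proof. by elim/quo_ind=> x; rewrite quo_sigmaE quo_sigmaVE sigmaK. Qed.

Lemma quo_sigmaVK : cancel quo_sigmaV quo_sigma.
Proof. by elim/quo_ind=> x; rewrite quo_sigmaVE quo_sigmaE sigmaVK. Qed.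

Lemma quo_sigma_continuous : continuous quo_sigma.
Proof.
apply: quo_continuous => x.
have -> : (fun x : G => quo_sigma (\pi_Q x)) = \pi_Q \o (sigma : G -> G).
  by apply/funext => y; exact: quo_sigmaE.
apply: continuous_comp; first exact: sigma_continuous.
exact: quo_pi_continuous.
Qed.

Lemma quo_sigmaV_continuous : continuous quo_sigmaV.
Proof.
apply: quo_continuous => x.
have -> : (fun x : G => quo_sigmaV (\pi_Q x)) = \pi_Q \o (sigmaV : G -> G).
  by apply/funext => y; exact: quo_sigmaVE.
apply: continuous_comp; first exact: sigmaV_continuous.
exact: quo_pi_continuous.
Qed.

HB.instance Definition _ := hasTopAutomorphism.Build Q
  quo_sigmaM quo_sigmaK quo_sigmaVK
  quo_sigma_continuous quo_sigmaV_continuous.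

End QuotientGroup.

(* [S ^ int] with the product of the discrete topologies. *)
Section FullShift.
Variable S : finGroupType.

Definition full_shift : Type :=
  prod_topology (fun _ : int => discrete_topology S).

HB.instance Definition _ := Topological.on full_shift.

Implicit Types f g : full_shift.

Definition shift_one : full_shift := fun=> (1 : S).
Definition shift_inv f : full_shift := fun n => (f n : S)^-1.
Definition shift_mul f g : full_shift := fun n => (f n : S) * (g n : S).

Lemma shift_mulA : associative shift_mul.
Proof. by move=> f g h; apply/funext => n; exact: mulgA. Qed.

Lemma shift_mul1 : left_id shift_one shift_mul.
Proof. by move=> f; apply/funext => n; exact: mul1g. Qed.

Lemma shift_mulr1 : right_id shift_one shift_mul.
Proof. by move=> f; apply/funext => n; exact: mulg1. Qed.

Lemma shift_mulV : left_inverse shift_one shift_inv shift_mul.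
Proof. by move=> f; apply/funext => n; exact: mulVg. Qed.

Lemma shift_mulrV : right_inverse shift_one shift_inv shift_mul.
Proof. by move=> f; apply/funext => n; exact: mulgV. Qed.

HB.instance Definition _ := isGroup.Build full_shift
  shift_mulA shift_mul1 shift_mulr1 shift_mulV shift_mulrV.

Lemma shift_cvg (T : topologicalType) (F : T -> full_shift) (x : T) :
  (forall n, \forall y \near x, F y n = F x n) -> {for x, continuous F}.
Proof.
move=> FP; apply/cvg_sup => n U.
rewrite nbhsE => -[V [[W oW <-] WF] VU].
rewrite -/(nbhs x (F @^-1` U)).
by apply: filterS (FP n) => y Fy; apply: VU; rewrite /preimage /= Fy.
Qed.

Lemma shift_proj (f : full_shift) n : \forall g \near f, g n = f n.
Proof.
have := @proj_continuous int (fun=> discrete_topology S) n f [set f n].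
by apply; exact: discrete_set1.
Qed.

Lemma shift_mulg_continuous :
  continuous (fun x : full_shift * full_shift => x.1 * x.2).
Proof.
move=> [f g]; apply: shift_cvg => n /=.
exists ([set f' : full_shift | f' n = f n], [set g' : full_shift | g' n = g n]).
  by split; exact: shift_proj.
by move=> [f' g'] /= [ff gg]; congr (mul _ _).
Qed.

Lemma shift_invg_continuous : continuous (fun x : full_shift => x^-1).
Proof.
move=> f; apply: shift_cvg => n.
apply: filterS (shift_proj f n) => g gf.
exact: (congr1 (fun s : S => s^-1) gf).
Qed.

HB.instance Definition _ := isTopologicalGroup.Build full_shift
  shift_mulg_continuous shift_invg_continuous.

Definition shift_sigma f : full_shift := fun n => f (n + 1)%R.
Definition shift_sigmaV f : full_shift := fun n => f (n - 1)%R.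

Lemma shift_sigmaM : {morph shift_sigma : f g / f * g}.
Proof. by []. Qed.

Lemma shift_sigmaK : cancel shift_sigma shift_sigmaV.
Proof.
by move=> f; apply/funext => n; rewrite /shift_sigmaV /shift_sigma GRing.subrK.
Qed.

Lemma shift_sigmaVK : cancel shift_sigmaV shift_sigma.
Proof.
by move=> f; apply/funext => n; rewrite /shift_sigmaV /shift_sigma GRing.addrK.
Qed.

Lemma shift_sigma_continuous : continuous shift_sigma.
Proof. by move=> f; apply: shift_cvg => n; exact: shift_proj. Qed.

Lemma shift_sigmaV_continuous : continuous shift_sigmaV.
Proof. by move=> f; apply: shift_cvg => n; exact: shift_proj. Qed.

HB.instance Definition _ := hasTopAutomorphism.Build full_shift
  shift_sigmaM shift_sigmaK shift_sigmaVK
  shift_sigma_continuous shift_sigmaV_continuous.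

End FullShift.

(* G >= Gs 1 >= Gs 2 >= ... >= Gs n = 1, where Sg i is the finite simple group
   belonging to Gs i / Gs i.+1.
   Only the values [Gs i] with [1 <= i <= n] and [Sg i] with [1 <= i < n] are
   meaningful. *)
Definition shift_series (G : starGroupType) (n : nat)
    (Gs : nat -> starSubgroup G) (Sg : nat -> finGroupType) : Prop :=
  [/\ (1 <= n)%N,
      exists nG1 : normal_subgroup (Gs 1%N),
        finite_set [set: quotient_group nG1],
      forall i, (1 <= i < n)%N ->
        [/\ (Gs i.+1 : set G) `<=` Gs i,
            simple [set: Sg i]%SET
          & exists nGi : normal_subgroup (relative_subgroup (Gs i) (Gs i.+1)),
              star_isomorphic (quotient_group nGi) (full_shift (Sg i))]
    & (Gs n : set G) = [set 1]].

(* Main.v *)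
Require Import Defs.
From HB Require Import structures.
From mathcomp Require Import all_boot ssralg ssrint fingroup perm morphism gseries.
From mathcomp Require Import quotient jordanholder.
From mathcomp Require Import generic_quotient.
From mathcomp Require Import all_classical topology.
From mathcomp Require Import ssrnum order zify.

(**
Fix an open normal subgroup [U] whose translates under [sigma] intersect in the
identity, and read the class of [sigma_pow i x] modulo [U] as the [i]-th
coordinate of [x].

A closed invariant subgroup [H] has finite memory: as the finite groups of
symbols that may follow a run of [k] trivial coordinates in [H] decrease with
[k], they stabilise, so an element of [H] with sufficiently many consecutive
trivial coordinates is a product of an element of [H] trivial to their left and
one trivial to their right.  Hence quotients are again expansive.

Existence.  Starting from [N = 1], let [N] be closed, invariant and normal in
[G].  If [G] has no nontrivial homoclinic element modulo [N], then [N] is open.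
Otherwise let [D] be the group of elements that are trivial modulo [N] outside
an interval of [m] places, with [m] minimal such that [D <> N].  By minimality
the translates of [D] commute and intersect trivially modulo [N], and they
generate a normal subgroup [M] with [M / N] the full shift on the finite group
[D / N].  Replace [N] by [M].  The process stops, since each step enlarges one
of two subgroups of [G / U]: the symbols that may follow, respectively precede,
an infinite run of trivial coordinates.  A composition series of [D / N]
refines [M / N] to full shifts on simple groups.

Uniqueness.  Let [V n] be the elements with trivial coordinates [0, ..., n - 1].
If [H / N] is the full shift on a simple group [T], then passing from the image
of [N] to that of [H] in [G / V n] adds, up to a bounded error, [n] composition
factors [T] and no other ones.  So the number of [i] with [Sg i] isomorphic to
[S] is the growth rate of the multiplicity of [S] in the finite groups
[G / V n].
*)

Set Implicit Arguments.
Unset Strict Implicit.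
Unset Printing Implicit Defensive.

Import Order.TTheory GRing.Theory Num.Theory.

Local Open Scope classical_set_scope.
Local Open Scope group_scope.

(** * Compact spaces and subsets of groups *)

Section Compact.
Variable T : topologicalType.
Hypothesis cT : compact [set: T].

(** Compactness in the form used below: an element subject to infinitely many closed conditions
    exists as soon as each finite stage can be met. *)
Lemma compact_chain (X : nat -> set T) :
  (forall n, closed (X n)) -> (forall m n, (m <= n)%N -> X n `<=` X m) ->
  (forall n, X n !=set0) -> exists x, forall n, X n x.
Proof.
move=> clX decX neX; apply: contrapT => noX.
have /compact_near_coveringP cov := cT.
have [|n _ /(_ n (leqnn n)) nX] := cov nat \oo (fun n x => ~ X n x) _.
- move=> x _; have /existsNP[n nXx] : ~ forall n, X n x.
    by move=> Xx; apply: noX; exists x.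
  exists (~` X n, [set m | (n <= m)%N]) => /=.
    split; last by exists n.
    by apply: open_nbhs_nbhs; split=> //; exact: closed_openC.
  by move=> [y m] /= [nXy nm] /(decX _ _ nm).
- by have [x] := neX n; exact: nX.
Qed.

Lemma compact_chain_sub (X : nat -> set T) (O : set T) :
  (forall n, closed (X n)) -> (forall m n, (m <= n)%N -> X n `<=` X m) ->
  open O -> (forall x, (forall n, X n x) -> O x) -> exists n, X n `<=` O.
Proof.
move=> clX decX oO XO; apply: contrapT => nXO.
have [|||x Xx] := @compact_chain (fun n => X n `&` ~` O).
- by move=> n; apply: closedI => //; exact: open_closedC.
- by move=> m n mn; apply: setSI; exact: decX.
- move=> n; apply: contrapT => /set0P/negP/negPn/eqP XO0; apply: nXO; exists n.
  by apply/subsets_disjoint.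
- by have /XO := fun n => (Xx n).1; exact: (Xx 0%N).2.
Qed.

(** In a compact Hausdorff space the quasi-component [Q] of [x] is connected, hence contained in the
    component of [x], which is a point here. *)
Lemma quasi_component_sub (x y : T) : hausdorff_space T ->
  totally_disconnected [set: T] ->
  (forall C, clopen C -> C x -> C y) -> y = x.
Proof.
move=> hT dT xy.
pose Q := [set z | forall C, clopen C -> C x -> C z].
have Qcl : closed Q.
  have -> : Q = \bigcap_(C in [set C | clopen C /\ C x]) C.
    by apply/seteqP; split=> z Qz C; [case=> + +; exact: Qz|move=> ? ?; exact: Qz].
  by apply: closed_bigI => C [[]].
have compQ (C : set T) : closed C -> compact C.
  by move=> cC; exact: subclosed_compact cC cT _.
(* The complement of [O] is compact and covered by complements of clopen neighbourhoods of [x], so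
   finitely many of these neighbourhoods already intersect inside [O]. *)
have clopen_sub (O : set T) : open O -> Q `<=` O ->
    exists C, [/\ clopen C, C x & C `<=` O].
  move=> oO QO.
  pose F := filter_from [set C : set T | clopen C /\ C x] id.
  have FF : Filter F.
    apply: filter_from_filter; first by exists setT; split=> //; exact: clopenT.
    move=> A B [cA Ax] [cB Bx]; exists (A `&` B) => //.
    by split=> //; exact: clopenI.
  have PF : ProperFilter F by apply: filter_from_proper => C [_ Cx]; exists x.
  have /compact_near_coveringP : compact (~` O).
    by apply: compQ; exact: open_closedC.
  move=> /(_ _ _ setC (powerset_filter_from_filter PF))[].
    move=> z nOz; have [C cC nCz] : exists2 C, clopen C /\ C x & ~ C z.
      apply: contrapT => noC; apply/nOz/QO => C cC Cx.
      by apply: contrapT => nCz; apply: noC; exists C.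
    exists (~` C, [set U | U `<=` C]); first split.
    - apply: open_nbhs_nbhs; split=> //; apply: closed_openC; exact: cC.1.2.
    - apply/near_powerset_filter_fromP; first by move=> ? ?; exact: subset_trans.
      by exists C => //; exists C.
    - by case=> i j [? /subsetC]; apply.
  move=> D [DF _ [C DC]] /(_ _ DC) nOC.
  have [E [cE Ex] EC] := DF _ DC; exists E; split=> //.
  by move=> z /EC Cz; apply: contrapT => /nOC.
have conQ : connected Q.
  suff key (A B : set T) : closed A -> closed B -> A `|` B = Q ->
      A `&` B = set0 -> A x -> A = Q.
    move=> B [b Bb] [U oU BU] [V cV BV].
    have cB : closed B by rewrite BV; exact: closedI.
    pose B' := Q `&` ~` U.
    have cB' : closed B' by apply: closedI => //; exact: open_closedC.
    have BB' : B `|` B' = Q by rewrite BU /B' -setIUr setUv setIT.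
    have BIB' : B `&` B' = set0 by rewrite BU /B' setIACA setICr setI0.
    have Qx : Q x by [].
    have [Bx|Bx] : B x \/ B' x by move: Qx; rewrite -BB'.
      exact: key cB cB' BB' BIB' Bx.
    have B'Q : B' = Q by apply: key cB' cB _ _ Bx; rewrite (setUC, setIC).
    have /seteqP[/(_ b) + _] := BIB'.
    by case; split=> //; rewrite B'Q -BB'; left.
  move=> cA cB ABQ AB0 Ax.
  have /(_ A cA (~` B)) := compact_normal hT cT.
  case=> [|A1 A1n A1B].
    apply/set_nbhsP; exists (~` B); split=> //; first exact: closed_openC.
    by apply/subsets_disjoint; rewrite setCK.
  have /set_nbhsP[U [oU AU UA1]] := A1n.
  have UB : closure U `&` B = set0.
    rewrite -subset0 => z [Uz Bz]; apply: (A1B z) => //.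
    exact: closure_subset Uz.
  have [||C [[oC cC] Cx CUB]] := clopen_sub (U `|` ~` closure U).
  - by apply: openU => //; apply: closed_openC; exact: closed_closure.
  - rewrite -ABQ => z [/AU Uz|Bz]; [by left|right=> Uz].
    by have : (closure U `&` B) z by []; rewrite UB.
  (* [C] avoids the boundary of [U], so [C] meets [U] and [closure U] in the same set; this clopen
     set contains [x], hence all of [Q], and it misses [B]. *)
  have CU : clopen (C `&` U).
    split; first exact: openI.
    have -> : C `&` U = C `&` closure U; last by apply: closedI => //; exact: closed_closure.
    apply/seteqP; split=> z [Cz Uz]; split=> //; first exact: subset_closure.
    by have [] := CUB z Cz.
  apply/seteqP; split=> z; first by rewrite -ABQ; left.
  move=> Qz; have [_ Uz] := Qz _ CU (conj Cx (AU _ Ax)).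
  have : Q z by []. rewrite -ABQ => -[//|Bz].
  have : (closure U `&` B) z by split=> //; exact: subset_closure.
  by rewrite UB.
have yQ : connected_component [set: T] x y by exists Q => //; split.
by move: yQ; rewrite dT.
Qed.

Lemma profinite_zero_dimensional : hausdorff_space T ->
  totally_disconnected [set: T] -> zero_dimensional T.
Proof.
move=> hT dT x y xy; apply: contrapT => noU.
move/eqP: xy; apply; apply/esym/quasi_component_sub => // C [oC cC] Cx.
by apply: contrapT => nCy; apply: noU; exists C; split.
Qed.

End Compact.

(** * Subgroups and products of subsets of an abstract group *)

Definition is_subgroup (G : groupType) (A : set G) :=
  [/\ A 1, forall x y, A x -> A y -> A (x * y) & forall x, A x -> A x^-1].

Definition is_normal (G : groupType) (A : set G) :=
  forall x y, A x -> A (x ^ y).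

(** The product set [A B]; only the first factor is quantified, the second one being determined by
    it. *)
Definition setmul (G : groupType) (A B : set G) : set G :=
  [set z | exists2 x, A x & B (x^-1 * z)].

Ltac gsimp := rewrite ?conjgE;
  do ?[rewrite ?(invgM, invgK, invg1, mulgA, mulgK, mulgVK, mul1g, mulg1, mulgV, mulVg)].

Section GroupSets.
Variable G : groupType.
Implicit Types (A B C : set G) (x y z : G).

Lemma sub1 A : is_subgroup A -> A 1. Proof. by case. Qed.
Lemma subM A x y : is_subgroup A -> A x -> A y -> A (x * y).
Proof. by case=> _ + _; apply. Qed.
Lemma subV A x : is_subgroup A -> A x -> A x^-1.
Proof. by case=> _ _; apply. Qed.
Lemma subVM A x y : is_subgroup A -> A x -> A y -> A (x^-1 * y).
Proof. by move=> sA Ax Ay; apply: subM => //; apply: subV. Qed.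
Lemma subMV A x y : is_subgroup A -> A x -> A y -> A (x * y^-1).
Proof. by move=> sA Ax Ay; apply: subM => //; apply: subV. Qed.
Lemma subVE A x : is_subgroup A -> A x^-1 -> A x.
Proof. by move=> sA /(subV sA); rewrite invgK. Qed.
Lemma subMl A x y : is_subgroup A -> A x -> A (x * y) -> A y.
Proof. by move=> sA Ax /(subVM sA Ax); rewrite mulKg. Qed.
Lemma subgroupT : is_subgroup [set: G]. Proof. by []. Qed.

Lemma subgroupI A B : is_subgroup A -> is_subgroup B -> is_subgroup (A `&` B).
Proof.
move=> sA sB; split; first by split; exact: sub1.
  by move=> x y [Ax Bx] [Ay By]; split; apply: subM.
by move=> x [Ax Bx]; split; apply: subV.
Qed.

Lemma setmulP A B x y : A x -> B y -> setmul A B (x * y).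
Proof. by move=> Ax By; exists x => //; rewrite mulKg. Qed.

Lemma setmul_subl A B : is_subgroup B -> A `<=` setmul A B.
Proof. by move=> sB x Ax; exists x => //; rewrite mulVg; apply: sub1. Qed.

Lemma setmul_subr A B : is_subgroup A -> B `<=` setmul A B.
Proof. by move=> sA x Bx; exists 1; rewrite ?invg1 ?mul1g //; apply: sub1. Qed.

Lemma setmulS A B A' B' : A `<=` A' -> B `<=` B' -> setmul A B `<=` setmul A' B'.
Proof. by move=> AA BB z [x /AA Ax /BB Bx]; exists x. Qed.

Lemma normal_conjV A x y : is_normal A -> A x -> A (y * x * y^-1).
Proof. by move=> nA /nA-/(_ y^-1); rewrite conjgE invgK mulgA. Qed.

Lemma is_normal_setmul A B : is_normal A -> is_normal B -> is_normal (setmul A B).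
Proof.
move=> nA nB z y [x Ax Bxz]; exists (x ^ y); first exact: nA.
by rewrite -conjVg -conjMg; exact: nB.
Qed.

Lemma is_subgroup_setmul A B : is_subgroup A -> is_subgroup B ->
  (forall x y, B x -> A y -> A (x * y * x^-1)) -> is_subgroup (setmul A B).
Proof.
move=> sA sB nA; split.
- by exists 1; rewrite ?invg1 ?mulg1; apply: sub1.
- move=> z w [x Ax Bz] [y Ay Bw].
  exists (x * (x^-1 * z * y * (x^-1 * z)^-1)); first by apply: subM => //; exact: nA.
  by have := subM sB Bz Bw; gsimp.
- move=> z [x Ax Bz]; exists (z^-1 * x * x^-1 * x^-1 * z).
    by have := nA _ _ (subV sB Bz) (subV sA Ax); gsimp.
  by have := subV sB Bz; gsimp.
Qed.

End GroupSets.

(** * Finite quotients *)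

Section FiniteQuotient.
Variables (G : groupType) (A B : set G).
Hypotheses (sA : is_subgroup A) (sB : is_subgroup B).
Hypothesis nB : forall x y, B x -> A y -> B (x ^ y).

Let eqv x y := A y /\ B (x^-1 * y).

Let eqv_refl x : A x -> eqv x x.
Proof. by move=> Ax; split=> //; rewrite mulVg; exact: sub1. Qed.

(** The set chosen from depends only on the coset of [x], which makes the representative
    canonical. *)
Let rho x : G := xget 1 [set y | eqv x y].

Let rhoP x : A x -> eqv x (rho x).
Proof. by move=> Ax; apply: (@xgetPex _ 1 [set y | eqv x y]); exists x; exact: eqv_refl. Qed.

Let rho_eq x y : A x -> B (x^-1 * y) -> rho x = rho y.
Proof.
move=> Ax Bxy; congr (xget 1 _); apply/seteqP; split=> z [Az Bz]; split=> //.
  by have := subVM sB Bxy Bz; gsimp.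
by have := subM sB Bxy Bz; gsimp.
Qed.

(** The carrier of [F] is the finite list of canonical representatives, multiplied in [G] and
    reduced by [rho]. It is the group [A / (A :&: B)]. *)
Lemma finite_quotient (s : seq G) :
  (forall x, A x -> exists2 y, y \in s & eqv x y) ->
  exists (F : finGroupType) (q : G -> F),
    [/\ forall x y, A x -> A y -> q (x * y) = q x * q y,
        forall x, A x -> (q x = 1 <-> B x)
      & forall t, exists2 x, A x & q x = t].
Proof.
move=> fin.
pose s' := [seq rho y | y <- s & `[< A y >]].
have s'P x : A x -> rho x \in s'.
  move=> Ax; have [y ys [Ay Bxy]] := fin x Ax; rewrite (rho_eq Ax Bxy).
  by apply: map_f; rewrite mem_filter ys andbT; apply/asboolP.
have s'A x : x \in s' -> A x.
  by move=> /mapP[y]; rewrite mem_filter => /andP[/asboolP/rhoP[]] ? _ _ ->.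
have rhoK x : x \in s' -> rho x = x.
  move=> /mapP[y]; rewrite mem_filter => /andP[/asboolP Ay _ ->].
  by have [_ Bx] := rhoP Ay; rewrite -(rho_eq Ay Bx).
pose T := seq_sub s'.
pose q0 (x : G) (Ax : A x) : T := SeqSub (s'P x Ax).
pose q (x : G) : T := insubd (q0 1 (sub1 sA)) (rho x).
have qE x : A x -> val (q x) = rho x by move=> Ax; rewrite val_insubd s'P.
have Aval (t : T) : A (val t) by exact/s'A/ssvalP.
have qval (t : T) : q (val t) = t by apply: val_inj; rewrite qE // rhoK // ssvalP.
pose mulT (a b : T) := q (val a * val b).
pose invT (a : T) := q (val a)^-1.
have qeq x y : A x -> A y -> B (x^-1 * y) -> q x = q y.
  by move=> Ax Ay Bxy; apply: val_inj; rewrite !qE //; exact: rho_eq.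
have qM x y : A x -> A y -> q (x * y) = mulT (q x) (q y).
  move=> Ax Ay; apply: qeq; [exact: subM|by apply: subM|].
  rewrite !qE //.
  have [Arx Bx] := rhoP Ax; have [Ary By] := rhoP Ay.
  by have := subM sB (nB Bx Ay) By; gsimp.
have mulA : associative mulT.
  move=> a b c; rewrite -[a]qval -[b]qval -[c]qval -!qM ?mulgA //.
    exact: subM.
  exact: subM.
have mul1 : left_id (q 1) mulT.
  by move=> a; rewrite -[a]qval -qM ?mul1g //; exact: sub1.
have invTE x : A x -> invT (q x) = q x^-1.
  move=> Ax; apply: qeq; rewrite ?qE //; do ?exact: subV.
    by apply: subV => //; have [] := rhoP Ax.
  have [Arx Bx] := rhoP Ax; by have := nB Bx (subV sA Ax); gsimp.
have mulV : left_inverse (q 1) invT mulT.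
  move=> a; rewrite -[a]qval invTE // -qM ?mulVg //; exact: subV.
pose FG := Finite_isGroup.Build T mulA mul1 mulV.
pose F : finGroupType := HB.pack T FG.
exists F, q; split.
- exact: qM.
- move=> x Ax; split=> [|Bx]; last first.
    by apply/esym/qeq => //; rewrite ?invg1 ?mul1g //; exact: sub1.
  move=> qx1; have : rho x = rho 1 by rewrite -!qE //; [congr val|exact: sub1].
  have [_ Bx] := rhoP Ax; have [_ ] := rhoP (sub1 sA).
  by rewrite invg1 mul1g => B1 rx; apply: subVE => //;
    have := subMV sB Bx B1; rewrite rx; gsimp.
- by move=> t; exists (val t); [exact: Aval|exact: qval].
Qed.

End FiniteQuotient.

(** * Compact topological groups *)

Section TopologicalGroup.
Variable G : topGroupType.
Implicit Types (A B U V : set G) (x y z : G).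

Lemma continuous_mulg (T : topologicalType) (f g : T -> G) :
  continuous f -> continuous g -> continuous (fun t => f t * g t).
Proof.
move=> cf cg t; apply: (@continuous_comp _ _ _ (fun t => (f t, g t))
  (fun z : G * G => z.1 * z.2)); last exact: mulg_continuous.
by apply: cvg_pair => /=; [exact: cf|exact: cg].
Qed.

Lemma continuous_invg (T : topologicalType) (f : T -> G) :
  continuous f -> continuous (fun t => (f t)^-1).
Proof.
by move=> cf t; apply: continuous_comp; [exact: cf|exact: invg_continuous].
Qed.

Lemma continuous_mull x : continuous (fun y => x * y).
Proof. by apply: continuous_mulg => ?; [exact: cvg_cst|exact: cvg_id]. Qed.

Lemma continuous_conjg : continuous (fun z : G * G => z.1 ^ z.2).
Proof.
apply: continuous_mulg; first by apply: continuous_invg => ?; exact: cvg_snd.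
by apply: continuous_mulg => ?; [exact: cvg_fst|exact: cvg_snd].
Qed.

Lemma open_subgroup A : is_subgroup A -> nbhs 1 A -> open A.
Proof.
move=> sA A1; rewrite openE => x Ax; rewrite /interior.
have := @continuous_mull x^-1 x A; rewrite mulVg => /(_ A1) /=.
rewrite /nbhs /=; apply: filterS => y /= Axy.
by have := subM sA Ax Axy; rewrite mulVKg.
Qed.

Lemma closed_subgroup A : is_subgroup A -> nbhs 1 A -> closed A.
Proof.
move=> sA A1; rewrite -[A]setCK; apply: open_closedC; rewrite openE => x nAx.
have := @continuous_mull x^-1 x A; rewrite mulVg => /(_ A1) /=.
rewrite /interior /nbhs /=; apply: filterS => y /= Axy Ay; apply: nAx.
by have := subMV sA Ay Axy; gsimp.
Qed.

Hypothesis cG : compact [set: G].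

Lemma finite_index A : is_subgroup A -> nbhs 1 A ->
  exists s : seq G, forall x, exists2 y, y \in s & A (y^-1 * x).
Proof.
move=> sA A1; have /compact_near_coveringP cov := cG.
(* Along the filter of finite lists ordered by inclusion, the covering form of compactness yields a
   finite list of coset representatives. *)
pose F := filter_from [set: seq G] (fun s => [set t : seq G | {subset s <= t}]).
have FF : Filter F.
  apply: filter_from_filter; first by exists [::].
  move=> s t _ _; exists (s ++ t) => // u stu.
  by split=> z zs; apply: stu; rewrite mem_cat zs ?orbT.
have [s _ /(_ s (fun _ => id)) sP] :
    F [set s | forall x, setT x -> exists2 y, y \in s & A (y^-1 * x)].
  apply: (cov _ F (fun s x => exists2 y, y \in s & A (y^-1 * x))) => x _.
  exists ([set y | A (x^-1 * y)], [set t : seq G | {subset [:: x] <= t}]).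
    split; last by exists [:: x].
    by have := @continuous_mull x^-1 x A; rewrite mulVg; apply.
  by move=> [y t] /= [Axy xt]; exists x => //; apply: xt; rewrite inE.
by exists s => x; exact: sP.
Qed.

(** By continuity [U (x ^ g')] holds for [(x, g')] near [(1, g)]; compactness makes the
    neighbourhood of [1] uniform in [g]. *)
Lemma normal_core U : nbhs 1 U -> nbhs 1 [set x | forall g, U (x ^ g)].
Proof.
move=> U1; have /compact_near_coveringP cov := cG.
apply: filterS (cov _ (nbhs (1 : G)) (fun x g => U (x ^ g)) _ _) => [x xU g|g _].
  exact: xU.
- have := @continuous_conjg (1, g) U; rewrite /= conj1g => /(_ U1) /=.
  rewrite {1}/nbhs /= => -[[P Q] /= [P1 Qg] PQ]; exists (Q, P) => //.
  by move=> [y x] /= [Qy Px]; exact: (PQ (x, y)).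
Qed.

(** The right stabiliser of a clopen neighbourhood [C] of [1] inside [U] is an open subgroup
    contained in [C]; its normal core is still open by [normal_core]. *)
Lemma open_normal_subgroup U : hausdorff_space G ->
  totally_disconnected [set: G] -> nbhs 1 U ->
  exists V, [/\ is_subgroup V, is_normal V, nbhs 1 V & V `<=` U].
Proof.
move=> hG dG U1.
have [C [C1 [oC cC]] CU] := zero_dimensional_cvg hG
  (profinite_zero_dimensional cG hG dG) cG U1.
have /compact_near_coveringP cov : compact C.
  exact: subclosed_compact cC cG _.
pose V := [set x | forall c, C c -> C (c * x)].
have V1 : nbhs 1 V.
  apply: filterS (cov _ (nbhs (1 : G)) (fun x c => C (c * x)) _ _) => [x Wx c|c Cc].
    exact: Wx.
  - have := @mulg_continuous G (c, 1) C; rewrite /= mulg1.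
    have nC : nbhs c C by apply: open_nbhs_nbhs.
    by move=> /(_ nC).
pose V' := V `&` [set x | V x^-1].
have sV' : is_subgroup V'.
  split; first by split=> c Cc; rewrite ?invg1 mulg1.
  - move=> x y [Vx Vx'] [Vy Vy']; split=> c Cc.
      by rewrite mulgA; apply/Vy/Vx.
    by rewrite invgM mulgA; apply/Vx'/Vy'.
  - by move=> x [Vx Vx']; split=> //=; rewrite invgK.
have V'1 : nbhs 1 V'.
  apply: filterI => //; have := @invg_continuous G 1 V.
  by rewrite invg1 => /(_ V1).
have V'U : V' `<=` U.
  by move=> x [/(_ 1 C1) + _]; rewrite mul1g => /CU.
exists [set x | forall g, V' (x ^ g)]; split.
- split=> [g|x y Vx Vy g|x Vx g]; first by rewrite conj1g; exact: sub1.
    by rewrite conjMg; apply: subM.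
  by rewrite conjVg; exact: subV.
- by move=> x y Vx g; rewrite -conjgM; exact: Vx.
- exact: normal_core.
- by move=> x /(_ 1); rewrite conjg1 => /V'U.
Qed.

Lemma closed_setmul A B : hausdorff_space G -> closed A -> closed B ->
  closed (setmul A B).
Proof.
move=> hG cA cB.
have -> : setmul A B = (fun z : G * G => z.1 * z.2) @` (A `*` B).
  apply/seteqP; split=> z [x Ax Bx].
    by exists (x, x^-1 * z) => //=; rewrite mulVKg.
  by case: x Ax Bx => x y [/= Ax By] <-; exact: setmulP.
apply: compact_closed => //; apply: continuous_compact.
  by apply: continuous_subspaceT => ?; exact: mulg_continuous.
by apply: compact_setX; apply: subclosed_compact cG _.
Qed.

(** The possible first factors of [z] at stage [n] form a decreasing chain of nonempty closed sets,
    so one first factor serves all stages. *)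
Lemma setmul_chain A (B : nat -> set G) z : closed A ->
  (forall n, closed (B n)) -> (forall m n, (m <= n)%N -> B n `<=` B m) ->
  (forall n, setmul A (B n) z) -> setmul A [set x | forall n, B n x] z.
Proof.
move=> cA cB decB ABz.
have [|||x Xx] := @compact_chain G cG (fun n => A `&` [set x | B n (x^-1 * z)]).
- move=> n; apply: closedI => //; apply: (@preimage_closed _ _ (fun x => x^-1 * z)) => //.
  move=> x _; apply: continuous_mulg => ?; last exact: cvg_cst.
  exact: invg_continuous.
- by move=> m n mn x [Ax /decB Bx]; split=> //; exact: Bx.
- by move=> n; have [x Ax Bx] := ABz n; exists x.
- by exists x => [|n]; [exact: (Xx 0%N).1|exact: (Xx n).2].
Qed.

End TopologicalGroup.

(** * Cylinder subgroups *)

Section FiniteChains.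
Variable F : finType.

Lemma decreasing_finset (K : nat -> {set F}) :
  (forall m n, (m <= n)%N -> K n \subset K m) ->
  exists k, forall n, (k <= n)%N -> K n = K k.
Proof.
move=> decK; pose P n := `[< exists k, #|K k| = n >].
have exP : exists n, P n by exists #|K 0%N|; apply/asboolP; exists 0%N.
case: (ex_minnP exP) => c /asboolP[k <-] cmin.
exists k => n kn; apply/eqP; rewrite eqEcard decK //=.
by apply: cmin; apply/asboolP; exists n.
Qed.

Lemma increasing_finset (K : nat -> {set F}) :
  (forall m n, (m <= n)%N -> K m \subset K n) ->
  exists k, forall n, (k <= n)%N -> K n = K k.
Proof.
move=> incK; have [|k kP] := @decreasing_finset (fun n => ~: K n).
  by move=> m n mn; rewrite finset.setCS; exact: incK.
by exists k => n /kP/finset.setC_inj.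
Qed.

End FiniteChains.

(** * Integer powers of the automorphism *)

Section Powers.
Variable G : starGroupType.
Implicit Types (x y : G) (i j : int).

Lemma sigma_powS i x : sigma_pow (i + 1)%R x = sigma (sigma_pow i x).
Proof.
case: i => [n|n].
  by have -> : (Posz n + 1 = Posz n.+1)%R by lia.
case: n => [|n]; first by rewrite /= sigmaVK.
by have -> : (Negz n.+1 + 1 = Negz n)%R; [lia|rewrite /= sigmaVK].
Qed.

Lemma sigma_powD i j x : sigma_pow (i + j)%R x = sigma_pow i (sigma_pow j x).
Proof.
elim/int_rect: i => [|n IH|n IH]; first by rewrite add0r.
  have -> : (n.+1%:Z + j = (n%:Z + j) + 1)%R by lia.
  by rewrite sigma_powS IH.
apply: (can_inj (@sigmaK G)); rewrite -!sigma_powS.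
have -> : (- n.+1%:Z + j + 1 = - n%:Z + j)%R by lia.
by have -> : (- n.+1%:Z + 1 = - n%:Z)%R by lia.
Qed.

Lemma sigma_powK i : cancel (@sigma_pow G i) (sigma_pow (- i)).
Proof. by move=> x; rewrite -sigma_powD addNr. Qed.

Lemma sigma_powNK i : cancel (@sigma_pow G (- i)) (sigma_pow i).
Proof. by move=> x; rewrite -sigma_powD subrr. Qed.

Lemma sigmaVM : {morph (@sigmaV G) : x y / x * y}.
Proof. by move=> x y; apply: (can_inj (@sigmaK G)); rewrite sigmaM !sigmaVK. Qed.

Lemma sigma_powM i : {morph (@sigma_pow G i) : x y / x * y}.
Proof.
case: i => n x y /=; first by elim: n => //= n ->; rewrite sigmaM.
by elim: n => [|n /= ->]; rewrite /= sigmaVM.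
Qed.

Lemma sigma_pow_one i : sigma_pow i (1 : G) = 1.
Proof. by apply: (mulgI (sigma_pow i 1)); rewrite -sigma_powM !mulg1. Qed.

Lemma sigma_powV i x : sigma_pow i x^-1 = (sigma_pow i x)^-1.
Proof.
by apply: (mulgI (sigma_pow i x)); rewrite -sigma_powM !mulgV sigma_pow_one.
Qed.

Lemma sigma_powJ i x y : sigma_pow i (x ^ y) = sigma_pow i x ^ sigma_pow i y.
Proof. by rewrite !conjgE !sigma_powM sigma_powV. Qed.

Lemma continuous_sigma_pow i : continuous (@sigma_pow G i).
Proof.
have iter_cont (f : G -> G) n : continuous f -> continuous (iter n f).
  move=> cf; elim: n => [|n IH] x; first exact: cvg_id.
  by apply: continuous_comp; [exact: IH|exact: cf].
by case: i => n; apply: iter_cont; [exact: sigma_continuous|exact: sigmaV_continuous].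
Qed.

End Powers.

(** The elements whose coordinates modulo [U] are trivial at all places selected by [P]: a cylinder
    for a finite interval, a half-infinite cylinder for a half-line. *)
Definition vset (G : starGroupType) (U : set G) (P : pred int) : set G :=
  [set x | forall i, P i -> U (sigma_pow i x)].

(** Unbundled form of [starSubgroup]; invariance is an equivalence so that powers of [sigma] can be
    both applied and cancelled. *)
Definition is_star_subgroup (G : starGroupType) (A : set G) :=
  [/\ closed A, is_subgroup A & forall x, A (sigma x) <-> A x].

Lemma star_sub_pow (G : starGroupType) (A : set G) i x :
  is_star_subgroup A -> A (sigma_pow i x) <-> A x.
Proof.
move=> [_ _ sA]; elim/int_rect: i => [|n IH|n IH] //.
  by apply: iff_trans IH; exact: sA.
have -> : sigma_pow (- n.+1%:Z)%R x = sigmaV (sigma_pow (- n%:Z)%R x).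
  by apply: (can_inj (@sigmaK G)); rewrite sigmaVK -sigma_powS; congr sigma_pow; lia.
by apply: iff_trans IH; rewrite -[X in _ <-> A X]sigmaVK; apply: iff_sym; exact: sA.
Qed.

Lemma star_sub_powI (G : starGroupType) (A : set G) i x :
  is_star_subgroup A -> A x -> A (sigma_pow i x).
Proof. by move=> AA Ax; apply/star_sub_pow. Qed.

Lemma star_sub_powE (G : starGroupType) (A : set G) i x :
  is_star_subgroup A -> A (sigma_pow i x) -> A x.
Proof. by move=> AA /star_sub_pow; apply. Qed.

Lemma is_star_subgroup1 (G : starGroupType) : hausdorff_space G ->
  is_star_subgroup [set 1 : G].
Proof.
move=> hG; split.
- by apply: accessible_closed_set1; exact: hausdorff_accessible.
- by split=> [//|x y -> ->|x ->]; rewrite /= ?mulg1 ?invg1.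
- move=> x; split=> [sx|->] /=; last exact: (sigma_pow_one G 1%:Z).
  by apply: (can_inj (@sigmaK G)); rewrite sx; apply/esym/(sigma_pow_one G 1%:Z).
Qed.

Section Cylinders.
Variables (G : starGroupType) (U : set G).
Implicit Types (P Q : pred int) (x y : G).

Lemma vset_sub P Q x : (forall i, Q i -> P i) -> vset U P x -> vset U Q x.
Proof. by move=> QP Px i /QP; exact: Px. Qed.

(** The coordinate of [sigma_pow j x] at [i] is that of [x] at [i + j]. *)
Lemma vset_shiftI P Q j x : (forall i, P i -> Q (i + j)%R) ->
  vset U Q x -> vset U P (sigma_pow j x).
Proof.
by move=> PQ Qx i Pi; rewrite -sigma_powD; apply: Qx; exact: PQ.
Qed.

Lemma vset_shiftE P Q j x : (forall i, Q i -> P (i - j)%R) ->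
  vset U P (sigma_pow j x) -> vset U Q x.
Proof.
by move=> QP Px i Qi; rewrite -[i](subrK j) sigma_powD; apply: Px; exact: QP.
Qed.

Lemma vset_subgroup P : is_subgroup U -> is_subgroup (vset U P).
Proof.
move=> sU; split=> [i _|x y Px Py i Pi|x Px i Pi].
- by rewrite sigma_pow_one; exact: sub1.
- by rewrite sigma_powM; apply: subM => //; [exact: Px|exact: Py].
- by rewrite sigma_powV; apply: subV => //; exact: Px.
Qed.

Lemma vset_normal P : is_normal U -> is_normal (vset U P).
Proof. by move=> nU x y Px i Pi; rewrite sigma_powJ; apply/nU/Px. Qed.

Lemma vset_closed P : closed U -> closed (vset U P).
Proof.
move=> cU; have -> : vset U P = \bigcap_(i in [set i | P i]) (@sigma_pow G i @^-1` U).
  by apply/seteqP; split=> x Px i Pi; exact: Px.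
apply: closed_bigI => i _; apply: preimage_closed => // x _.
exact: continuous_sigma_pow.
Qed.

Lemma vset_nbhs (m n : int) : nbhs 1 U -> nbhs 1 (vset U (fun i => (m <= i < n)%R)).
Proof.
move=> U1; have U1i i : nbhs 1 (@sigma_pow G i @^-1` U).
  by apply: (@continuous_sigma_pow G i 1 U); rewrite sigma_pow_one.
suff key k : nbhs 1 (vset U (fun i => (m <= i < m + k%:Z)%R)).
  have [nm|mn] := leP n m.
    by apply: filterS (key 0%N) => x _ i; lia.
  by apply: filterS (key `|n - m|%N) => x; apply: vset_sub => i; lia.
elim: k => [|k IH]; first by apply: filterS (filterT) => x _ i; lia.
apply: filterS (filterI IH (U1i (m + k%:Z)%R)) => x [Vx Ux] i ik.
by have [->//|ik'] := eqVneq i (m + k%:Z)%R; apply: Vx; lia.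
Qed.

End Cylinders.

(** * Splitting and gluing *)

(** [F] is the finite alphabet of the coding: the symbol of [x] at place [i] is
    [q (sigma_pow i x)]. *)
Lemma open_quotient (G : topGroupType) (U : set G) : compact [set: G] ->
  is_subgroup U -> is_normal U -> nbhs 1 U ->
  exists (F : finGroupType) (q : G -> F),
    [/\ {morph q : x y / x * y}, forall x y, q x = q y <-> U (x^-1 * y)
      & forall t, exists x, q x = t].
Proof.
move=> cG sU nU U1; have [s sP] := finite_index cG sU U1.
have [||x _|F [q [qM qU qS]]] := @finite_quotient _ setT U _ sU _ s _.
- exact: subgroupT.
- by move=> x y Ux _; exact: nU.
- have [y ys Uyx] := sP x; exists y => //; split=> //.
  by have := subV sU Uyx; gsimp.
have qM' : {morph q : x y / x * y} by move=> x y; exact: qM.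
exists F, q; split=> // [x y|t]; last by have [x _ <-] := qS t; exists x.
rewrite -qU // qM'; have qVx : q x^-1 = (q x)^-1.
  apply: (mulIg (q x)); rewrite -qM' !mulVg; apply/qU => //.
  exact: sub1.
rewrite qVx; split=> [->|]; first by rewrite mulVg.
by move=> /mulg1_eq; rewrite invgK.
Qed.

Section Splitting.
Variables (G : starGroupType) (U : set G).
Hypothesis cG : compact [set: G].
Hypotheses (sU : is_subgroup U) (nU : is_normal U) (U1 : nbhs 1 U).
Implicit Types (H N M : set G) (x y : G) (a b : int).

Let cU : closed U. Proof. exact: closed_subgroup. Qed.
Let sV P : is_subgroup (vset U P). Proof. exact: vset_subgroup. Qed.
Let cV P : closed (vset U P). Proof. exact: vset_closed. Qed.

Let closed_div A (x : G) : closed A -> closed [set y | A (y^-1 * x)].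
Proof.
move=> cA; apply: (@preimage_closed _ _ (fun y : G => y^-1 * x)) => // y _.
by apply: continuous_mulg => ?; [exact: invg_continuous|exact: cvg_cst].
Qed.

(** Finite memory at place [0]: after [k] trivial coordinates, the part of [x] from [0] on can be
    continued to the left by trivial coordinates without leaving [H]. *)
Lemma splitting0 H : is_star_subgroup H ->
  exists k : nat, forall x, H x -> vset U (fun i => (- k%:Z <= i < 0)%R) x ->
    exists y, [/\ H y, vset U (fun i => (i < 0)%R) y
                & vset U (fun i => (- k%:Z <= i)%R) (y^-1 * x)].
Proof.
move=> HH; have [cH sH iH] := HH.
have [F [q [qM qU _]]] := open_quotient cG sU nU U1.
pose L (j : nat) := H `&` vset U (fun i => (- j%:Z <= i < 0)%R).
have decL m n : (m <= n)%N -> L n `<=` L m.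
  by move=> mn x [Hx Vx]; split=> //; apply: vset_sub Vx => i; lia.
have cL j : closed (L j) by apply: closedI.
(* The symbols that occur in [H] at place [0] after [j] trivial coordinates; they are constant from
   some [k] on. *)
pose K j := [set t : F | `[< exists2 x, L j x & q x = t >]]%SET.
have [|k kP] := @decreasing_finset F K.
  move=> m n mn; apply/fintype.subsetP => t; rewrite !finset.inE.
  move=> /asboolW[x Lx qx]; have {}Lx := decL _ _ mn _ Lx.
  by apply/asboolP; exists x.
(* The symbol of [x] at [0] lies in every [K j], so by compactness an element trivial at all
   negative places has it too. *)
have lift0 x : L k x -> exists y, [/\ H y, vset U (fun i => (i < 0)%R) y & U (y^-1 * x)].
  move=> Lx.
  have [|||y yP] := @compact_chain G cG (fun j => L j `&` [set y | U (y^-1 * x)]).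
  - by move=> j; apply: closedI => //; exact: closed_div.
  - by move=> m n mn; apply: setSI; exact: decL.
  - move=> j; have : q x \in K (j + k)%N.
      by rewrite kP ?leq_addl // finset.inE; apply/asboolP; exists x.
    rewrite finset.inE => /asboolW[y Ly /qU Uy]; exists y; split=> //.
    by apply: decL Ly; exact: leq_addr.
  exists y; split; first by have [[]] := yP 0%N.
    move=> i i0; have [[_ Vy] _] := yP `|i|%N; apply: Vy; lia.
  by have [] := yP 0%N.
exists k => x Hx Vx.
pose X m := H `&` vset U (fun i => (i < 0)%R) `&`
  [set y | vset U (fun i => (- k%:Z <= i < m%:Z)%R) (y^-1 * x)].
have [|||y yP] := @compact_chain G cG X.
- by move=> m; apply: closedI; [exact: closedI|exact: closed_div].
- by move=> m n mn y [? /= Vy]; split=> //=; apply: vset_sub Vy => i; lia.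
- elim=> [|m [y [[Hy Vy] /= Vyx]]].
    exists 1; split; first by split; exact: sub1.
    by rewrite /= invg1 mul1g.
  (* The error of [y] at place [m] is removed by an element trivial to the left of [m], which spoils
     no earlier place. *)
  have [|z [Hz Vz Uz]] := lift0 (sigma_pow m%:Z (y^-1 * x)).
    split; first by apply: (star_sub_powI _ HH); apply: subVM.
    by apply: vset_shiftI Vyx => i; lia.
  pose z' := sigma_pow (- m%:Z)%R z.
  have Vz' : vset U (fun i => (i < m%:Z)%R) z'.
    by apply: vset_shiftI Vz => i; lia.
  exists (y * z'); split; first split.
  + by apply: subM => //; apply: (star_sub_powI _ HH).
  + by apply: (subM (sV _)) => //; apply: vset_sub Vz' => i; lia.
  + move=> i ik; rewrite invgM -mulgA.
    have [im|im] := eqVneq i (Posz m).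
      by rewrite im sigma_powM sigma_powV /z' sigma_powNK.
    have im' : (- k%:Z <= i < m%:Z)%R by lia.
    by rewrite sigma_powM sigma_powV; apply: subVM => //; [apply: Vz'; lia|exact: Vyx].
exists y; split; first by have [[]] := yP 0%N.
  by have [[]] := yP 0%N.
by move=> i ik; have [_ Vy] := yP `|i|.+1; apply: Vy; lia.
Qed.

Lemma splitting H : is_star_subgroup H ->
  exists k : nat, forall a x, H x -> vset U (fun i => (a - k%:Z <= i < a)%R) x ->
    exists y, [/\ H y, vset U (fun i => (i < a)%R) y
                & vset U (fun i => (a - k%:Z <= i)%R) (y^-1 * x)].
Proof.
move=> HH; have [k kP] := splitting0 HH; exists k => a x Hx Vx.
have [||y [Hy Vy Vyx]] := kP (sigma_pow a x).
- by apply: (star_sub_powI _ HH).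
- by apply: vset_shiftI Vx => i; lia.
exists (sigma_pow (- a) y); split.
- by apply: (star_sub_powI _ HH).
- by apply: vset_shiftI Vy => i; lia.
- have -> : (sigma_pow (- a) y)^-1 * x = sigma_pow (- a)%R (y^-1 * sigma_pow a x).
    by rewrite sigma_powM sigma_powV sigma_powK.
  by apply: vset_shiftI Vyx => i; lia.
Qed.

(** The representatives [u] and [v] of [x] modulo [N] differ by an element of [N] trivial on the
    overlap. Splitting it at [b] gives [y] in [N] such that [u * y] behaves like [u] left of [b] and
    like [v] from [b - k] on. *)
Lemma gluing N : is_star_subgroup N ->
  exists k : nat, forall a b c d x, (a <= c)%R -> (b <= d)%R -> (c + k%:Z <= b)%R ->
    setmul (vset U (fun i => (a <= i < b)%R)) N x ->
    setmul (vset U (fun i => (c <= i < d)%R)) N x ->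
    setmul (vset U (fun i => (a <= i < d)%R)) N x.
Proof.
move=> NN; have [_ sN _] := NN; have [k kP] := splitting NN; exists k.
move=> a b c d x ac bd cb [u Vu Nu] [v Vv Nv].
have Nuv : N (u^-1 * v) by have := subMV sN Nu Nv; gsimp.
have [|y [Ny Vy Vyuv]] := kP b (u^-1 * v) Nuv.
  by apply: (subVM (sV _)); [apply: vset_sub Vu|apply: vset_sub Vv] => i; lia.
exists (u * y); last by rewrite invgM -mulgA; exact: subVM.
have Vuy : vset U (fun i => (a <= i < b)%R) (u * y).
  by apply: (subM (sV _)) => //; apply: vset_sub Vy => i; lia.
have Vuy' : vset U (fun i => (b - k%:Z <= i < d)%R) (u * y).
  have -> : u * y = v * (y^-1 * (u^-1 * v))^-1 by gsimp.
  by apply: (subMV (sV _)); [apply: vset_sub Vv|apply: vset_sub Vyuv] => i; lia.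
by move=> i iad; have [ib|ib] := ltP i b; [apply: Vuy|apply: Vuy']; lia.
Qed.

Lemma gluing_interval N : is_star_subgroup N ->
  exists k : nat, forall a (n : nat) x,
    (forall i, (i < n)%N -> setmul (vset U (fun j => (0 <= j < k%:Z)%R)) N
                              (sigma_pow (a + i%:Z)%R x)) ->
    setmul (vset U (fun j => (a <= j < a + n%:Z)%R)) N x.
Proof.
(* Windows of length [k.+1], each displaced by one place from the previous one, overlap in the [k]
   places needed for gluing. *)
move=> NN; have [k kP] := gluing NN; exists k.+1 => a n x xP.
have shiftN j m m' y : setmul (vset U (fun i => (m <= i < m')%R)) N (sigma_pow j y) ->
    setmul (vset U (fun i => (m + j <= i < m' + j)%R)) N y.
  move=> [u Vu Nu]; exists (sigma_pow (- j)%R u).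
    by apply: vset_shiftI Vu => i; lia.
  apply: (@star_sub_powE _ _ j _ NN).
  by rewrite sigma_powM sigma_powV sigma_powNK.
case: n xP => [|n] xP.
  exists x; first by move=> i; lia.
  by rewrite mulVg; have [_ sN _] := NN; exact: sub1.
have : setmul (vset U (fun j => (a <= j < a + n%:Z + k.+1%:Z)%R)) N x; last first.
  move=> [u Vu Nu]; exists u => //; apply: vset_sub Vu => i; lia.
elim: n xP => [|n IH] xP.
  have := xP 0%N isT => /shiftN [u Vu Nu]; exists u => //.
  by apply: vset_sub Vu => i; lia.
have /shiftN H2 := xP n.+1 (ltnSn _).
have H1 := IH (fun i im => xP i (ltnW im)).
have := kP _ _ _ _ _ _ _ _ H1 H2.
case=> [|||u Vu Nu]; try lia.
by exists u => //; apply: vset_sub Vu => i; lia.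
Qed.

End Splitting.

(** * Ascending chains of star subgroups *)

(** [H / N] is the full shift on [T], expressed by a coordinate map on [H] without quotient types.
    The last clause is continuity at [1] in the coordinate [0]; translation and [sigma] carry it to
    all points and places. *)
Definition shift_factor (G : starGroupType) (H N : set G) (T : finGroupType) :=
  exists f : G -> int -> T,
    [/\ forall x y i, H x -> H y -> f (x * y) i = f x i * f y i,
        forall x i, H x -> f (sigma x) i = f x (i + 1)%R,
        forall x, H x -> (N x <-> forall i, f x i = 1),
        forall s, exists2 x, H x & forall i, f x i = s i
      & exists2 O, nbhs 1 O & forall x, H x -> O x -> f x 0 = 1].

Definition open_in (G : topGroupType) (N M : set G) :=
  exists2 O, nbhs 1 O & forall x, M x -> O x -> N x.

Section SetMul.
Variable G : groupType.
Implicit Types (A B : set G).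

Lemma setmulC A B : is_normal A -> setmul A B `<=` setmul B A.
Proof.
move=> nA x [a Aa Bx]; exists (a^-1 * x) => //.
by have := nA _ (a^-1 * x) Aa; gsimp.
Qed.

Lemma setmul_subgroup A B : is_subgroup A -> is_subgroup B -> is_normal A ->
  is_subgroup (setmul A B).
Proof.
by move=> sA sB nA; apply: is_subgroup_setmul => // x y _ Ay; exact: normal_conjV.
Qed.

End SetMul.

(** * Criteria for openness in terms of half-infinite cylinders *)

Section Dynamics.
Variable G : starGroupType.
Hypotheses (cG : compact [set: G]) (hG : hausdorff_space G).

(** Dividing by elements of [N] pushes an element of [P 0] down the chain; in the limit it is a
    product of an element of [N] and one of the intersection, which lies in [N]. *)
Lemma chain_absorb (N : set G) (P : nat -> set G) : closed N -> is_subgroup N ->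
  (forall n, closed (P n)) -> (forall m n, (m <= n)%N -> P n `<=` P m) ->
  (forall x, (forall n, P n x) -> N x) ->
  (forall n x, P n x -> exists y, N y /\ P n.+1 (y^-1 * x)) -> P 0%N `<=` N.
Proof.
move=> cN sN cP decP PN stepP x P0x.
have NP n : setmul N (P n) x.
  elim: n => [|n [y Ny Py]]; first exact: (setmul_subr sN).
  have [z [Nz Pz]] := stepP _ _ Py; exists (y * z); first exact: subM.
  by rewrite invgM -mulgA.
have [y Ny Py] := setmul_chain cG cN cP decP NP.
by rewrite -(mulVKg y x); apply: subM => //; exact: PN.
Qed.

(** Subgroups containing [E 0] are determined by their images in the finite group [G / E 0]. *)
Lemma increasing_stable (E : nat -> set G) : (forall n, is_subgroup (E n)) ->
  is_normal (E 0%N) -> nbhs 1 (E 0%N) ->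
  (forall m n, (m <= n)%N -> E m `<=` E n) ->
  exists n, forall m, (n <= m)%N -> E m `<=` E n.
Proof.
move=> sE nE E1 incE; have [F [q [_ qE _]]] := open_quotient cG (sE 0%N) nE E1.
pose K n := [set t : F | `[< exists2 x, E n x & q x = t >]]%SET.
have [|k kP] := @increasing_finset F K.
  move=> m n mn; apply/fintype.subsetP => t; rewrite !finset.inE.
  by move=> /asboolW[x /(incE _ _ mn) Ex qx]; apply/asboolP; exists x.
exists k => m km x Ex; have : q x \in K k.
  by rewrite -(kP m km) finset.inE; apply/asboolP; exists x.
rewrite finset.inE => /asboolW[y Ey /qE Eyx].
rewrite -(mulVKg y x); apply: subM => //; exact: incE Eyx.
Qed.

Lemma setmul_vset_shift W (P Q P' Q' : pred int) l (x : G) :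
  (forall i, P' i -> P (i - l)%R) -> (forall i, Q' i -> Q (i - l)%R) ->
  setmul (vset W P) (vset W Q) (sigma_pow l x) -> setmul (vset W P') (vset W Q') x.
Proof.
move=> PP QQ [a Pa Qx]; exists (sigma_pow (- l)%R a).
  by apply: (@vset_shiftE _ _ P _ l) => //; rewrite sigma_powNK.
apply: (@vset_shiftE _ _ Q _ l) => //.
by rewrite sigma_powM sigma_powV sigma_powNK.
Qed.

(** If [N] realises every symbol of [M] that follows, or precedes, an infinite trivial run, then
    clearing symbols one place at a time shows that elements of [M] trivial on a half-line lie in
    [N]. By splitting, an element of [M] trivial on a long window is a product of two such
    elements. *)
Lemma open_in_of_equal_ends (U N M : set G) : is_subgroup U -> is_normal U -> nbhs 1 U ->
  (forall x : G, (forall i, U (sigma_pow i x)) -> x = 1) ->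
  is_star_subgroup N -> is_star_subgroup M ->
  (forall x, M x -> vset U (fun i => (i < 0)%R) x ->
     exists y, [/\ N y, M y, vset U (fun i => (i < 0)%R) y & U (y^-1 * x)]) ->
  (forall x, M x -> vset U (fun i => (0 < i)%R) x ->
     exists y, [/\ N y, M y, vset U (fun i => (0 < i)%R) y & U (y^-1 * x)]) ->
  open_in N M.
Proof.
move=> sU nU U1 expU NN MM fwd bwd; have [cN sN _] := NN; have [cM sM _] := MM.
have sV P : is_subgroup (vset U P) by exact: vset_subgroup.
have cV P : closed (vset U P) by apply: vset_closed; exact: closed_subgroup.
have MN_lt : M `&` vset U (fun i => (i < 0%N%:Z)%R) `<=` N.
  apply: (@chain_absorb _ (fun n => M `&` vset U (fun i => (i < n%:Z)%R))) => //.
  - by move=> n; exact: closedI.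
  - by move=> m n mn x [Mx Vx]; split=> //; apply: vset_sub Vx => i; lia.
  - move=> x xP; rewrite (expU x) => [|i]; first exact: sub1.
    by have [_ Vx] := xP `|i|.+1; apply: Vx; lia.
  move=> n x [Mx Vx]; have [||y [Ny My Vy Uy]] := fwd (sigma_pow n%:Z x).
  - exact: star_sub_powI.
  - by apply: vset_shiftI Vx => i; lia.
  exists (sigma_pow (- n%:Z)%R y); split; first exact: star_sub_powI.
  split; first by apply: subVM => //; exact: star_sub_powI.
  apply: (@vset_shiftE _ _ (fun i => (i < 1)%R) _ n%:Z) => [i|]; first by lia.
  rewrite sigma_powM sigma_powV sigma_powNK => i i1.
  have [->|i0] := eqVneq i 0%R; first exact: Uy.
  have {}i0 : (i < 0)%R by lia.
  rewrite sigma_powM sigma_powV; apply: subVM => //; first exact: Vy.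
  by rewrite -sigma_powD; apply: Vx; lia.
have MN_gt : M `&` vset U (fun i => (- 0%N%:Z < i)%R) `<=` N.
  apply: (@chain_absorb _ (fun n => M `&` vset U (fun i => (- n%:Z < i)%R))) => //.
  - by move=> n; exact: closedI.
  - by move=> m n mn x [Mx Vx]; split=> //; apply: vset_sub Vx => i; lia.
  - move=> x xP; rewrite (expU x) => [|i]; first exact: sub1.
    by have [_ Vx] := xP `|i|.+1; apply: Vx; lia.
  move=> n x [Mx Vx]; have [||y [Ny My Vy Uy]] := bwd (sigma_pow (- n%:Z)%R x).
  - exact: star_sub_powI.
  - by apply: vset_shiftI Vx => i; lia.
  exists (sigma_pow n%:Z%R y); split; first exact: star_sub_powI.
  split; first by apply: subVM => //; exact: star_sub_powI.
  apply: (@vset_shiftE _ _ (fun i => (-1 < i)%R) _ (- n%:Z)%R) => [i|]; first by lia.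
  rewrite sigma_powM sigma_powV sigma_powK => i i1.
  have [->|i0] := eqVneq i 0%R; first exact: Uy.
  have {}i0 : (0 < i)%R by lia.
  rewrite sigma_powM sigma_powV; apply: subVM => //; first exact: Vy.
  by rewrite -sigma_powD; apply: Vx; lia.
have [k kP] := splitting cG sU nU U1 MM.
(* The window starts at [1] because the right-hand condition in [MN_gt] concerns the places
   [0 < i]. *)
exists (vset U (fun i => (1 <= i < 1 + k%:Z)%R)); first exact: vset_nbhs.
move=> x Mx Vx; have [|y [My Vy Vyx]] := kP (1 + k%:Z)%R x Mx.
  by apply: vset_sub Vx => i; lia.
rewrite -(mulVKg y x); apply: subM => //.
  by apply: MN_lt; split=> //; apply: vset_sub Vy => i; lia.
apply: MN_gt; split; first exact: subVM.
by apply: vset_sub Vyx => i; lia.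
Qed.

Section Modulo.
Variable W : set G.
Hypotheses (sW : is_subgroup W) (nW : is_normal W) (W1 : nbhs 1 W).
(** [N] is the kernel of the coding by [W], so coordinates modulo [W] are coordinates for
    [G / N]. *)
Let N := vset W predT.

Let cW : closed W. Proof. exact: closed_subgroup. Qed.
Let sV P : is_subgroup (vset W P). Proof. exact: vset_subgroup. Qed.
Let nV P : is_normal (vset W P). Proof. exact: vset_normal. Qed.
Let cV P : closed (vset W P). Proof. exact: vset_closed. Qed.

Lemma vset_star : is_star_subgroup N.
Proof.
split; [exact: cV|exact: sV|move=> x]; split=> Nx i _; last first.
  by rewrite -[sigma x]/(sigma_pow 1 x) -sigma_powD; exact: Nx.
by rewrite -[i](subrK 1%R) sigma_powD; exact: Nx.
Qed.

(** Without homoclinic elements modulo [N], elements of [A a] and [B b] can agree only in [N]. A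
    stabilising chain then forces every [A j] and [B j] into [N], while [A 0] times [B (- k)] is a
    neighbourhood of [1] by splitting. *)
Lemma open_of_no_homoclinic :
  (forall m : nat, vset W (fun i => (i < 0)%R || (m%:Z <= i)%R) `<=` N) ->
  nbhs 1 N.
Proof.
move=> noD.
pose A j := vset W (fun i => (i < j)%R); pose B j := vset W (fun i => (j <= i)%R).
have ABN a b : A a `&` B b `<=` N.
  move=> x [Ax Bx]; apply: (star_sub_powE vset_star (i := a)).
  apply: (noD `|b - a|%N) => i /orP[ia|ib]; rewrite -sigma_powD.
    by apply: Ax; lia.
  by apply: Bx; lia.
have TT : is_star_subgroup [set: G].
  by split=> //; exact: closedT.
have [k kP] := splitting cG sW nW W1 TT.
have AB1 : nbhs 1 (setmul (A 0) (B (- k%:Z)%R)).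
  apply: filterS (vset_nbhs (- k%:Z)%R 0 W1) => x Vx.
  have [//||y [_ Ay By]] := kP 0%R x.
    by apply: vset_sub Vx => i; lia.
  by exists y => //; apply: vset_sub By => i; lia.
have BN j : B j `<=` N.
  have [|||m n mn|n nP] := @increasing_stable (fun n => setmul (A 0) (B (n%:Z - k%:Z)%R)).
  - by move=> n; exact: (setmul_subgroup (sV _) (sV _) (@nV _)).
  - exact: (is_normal_setmul (@nV _) (@nV _)).
  - by rewrite sub0r.
  - by apply: setmulS => // x; apply: vset_sub => i; lia.
  (* Shifted to where the chain is stable, [x] factors as [a] in [A 0] times an element of
     [B (n - k)]. Then [a] is homoclinic, hence in [N], and [x] gains one more trivial place. *)
  have BB l : B (l + 1)%R `<=` B l.
    move=> x Bx; pose e := (l - (n%:Z - k%:Z))%R.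
    have := nP n.+1 (leqnSn n) (sigma_pow e x); case.
      apply: (setmul_subr (sV _)); apply: vset_shiftI Bx => i; rewrite /e; lia.
    move=> a Aa Ba; have Na : N a.
      apply: (ABN 0%R (n.+1%:Z - k%:Z)%R); split=> //.
      have -> : a = sigma_pow e x * (a^-1 * sigma_pow e x)^-1 by gsimp.
      apply: (subMV (sV _)); last by apply: vset_sub Ba => i; lia.
      by apply: vset_shiftI Bx => i; rewrite /e; lia.
    apply: (@vset_shiftE _ _ (fun i => (n%:Z - k%:Z <= i)%R) _ e).
      by move=> i; rewrite /e; lia.
    by apply: (subMl (sV _) _ Ba); apply: (subV (sV _)); apply: vset_sub Na.
  have BBn l n0 : B (l + n0%:Z)%R `<=` B l.
    elim: n0 => [|n0 IH]; first by rewrite addr0.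
    by apply: subset_trans IH => x Bx; apply: BB; apply: vset_sub Bx => i; lia.
  move=> x Bx i _.
  have [ji|ij] := leP j i; first exact: Bx.
  by apply: (BBn i `|j - i|%N x); [apply: vset_sub Bx => l|]; lia.
have AN j : A j `<=` N.
  have [|||m n mn|n nP] := @increasing_stable (fun n => setmul (A (- n%:Z)%R) (B (- k%:Z)%R)).
  - by move=> n; exact: (setmul_subgroup (sV _) (sV _) (@nV _)).
  - exact: (is_normal_setmul (@nV _) (@nV _)).
  - by rewrite oppr0.
  - by apply: setmulS => // x; apply: vset_sub => i; lia.
  have AA l : A (l - 1)%R `<=` A l.
    move=> x Ax; pose e := (l + n%:Z)%R.
    have := nP n.+1 (leqnSn n) (sigma_pow e x); case.
      apply: (setmul_subl (sV _)); apply: vset_shiftI Ax => i; rewrite /e; lia.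
    move=> a Aa Ba; have Nb : N (a^-1 * sigma_pow e x).
      apply: (ABN (- n.+1%:Z)%R (- k%:Z)%R); split=> //.
      apply: (subVM (sV _)); first by apply: vset_sub Aa => i; lia.
      by apply: vset_shiftI Ax => i; rewrite /e; lia.
    apply: (@vset_shiftE _ _ (fun i => (i < - n%:Z)%R) _ e).
      by move=> i; rewrite /e; lia.
    rewrite -(mulVKg a (sigma_pow e x)).
    by apply: (subM (sV _)) => //; apply: vset_sub Nb.
  have AAn l n0 : A (l - n0%:Z)%R `<=` A l.
    elim: n0 => [|n0 IH]; first by rewrite subr0.
    by apply: subset_trans IH => x Ax; apply: AA; apply: vset_sub Ax => i; lia.
  move=> x Ax i _.
  have [ij|ji] := ltP i j; first exact: Ax.
  by apply: (AAn (i + 1)%R `|(i + 1 - j)%R|%N x); [apply: vset_sub Ax => l|]; lia.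
apply: filterS AB1 => x [a /AN Na /BN Nx].
by rewrite -(mulVKg a x); apply: (subM (sV _)).
Qed.

End Modulo.
End Dynamics.

(** * The shift of minimal homoclinic elements *)

Lemma open_in_sub (G : topGroupType) (N M : set G) : is_subgroup N ->
  N `<=` M -> is_subgroup M -> open_in N M ->
  exists O, [/\ open O, N `<=` O & forall x, M x -> O x -> N x].
Proof.
move=> sN NM sM [O]; rewrite nbhsE => -[O' [oO' O'1] O'O] ON.
exists (\bigcup_(n in N) (fun x => n^-1 * x) @^-1` O'); split.
- apply: bigcup_open => n _; apply: open_comp => // x _; exact: continuous_mull.
- by move=> n Nn; exists n => //=; rewrite mulVg.
- move=> x Mx [n Nn O'nx]; rewrite -(mulVKg n x); apply: subM => //.
  by apply: ON; [apply: subVM => //; exact: NM|exact: O'O].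
Qed.

Section HomoclinicShift.
Variable G : starGroupType.
Hypotheses (cG : compact [set: G]) (hG : hausdorff_space G).
Variable W : set G.
Hypotheses (sW : is_subgroup W) (nW : is_normal W) (W1 : nbhs 1 W).
Let N := vset W predT.
Variable p : nat.

Let cW : closed W. Proof. exact: closed_subgroup. Qed.
Let sV P : is_subgroup (vset W P). Proof. exact: vset_subgroup. Qed.
Let nV P : is_normal (vset W P). Proof. exact: vset_normal. Qed.
Let cV P : closed (vset W P). Proof. exact: vset_closed. Qed.
Let N_star : is_star_subgroup N. Proof. exact: vset_star. Qed.

(* [Dp] gives [A j `&` B j = N], so the factorisation [x = a * b] of [x] in [M]
   at a place [j] is unique modulo [N]; those at [0] and [1] differ by an element
   of [D], which is the coordinate of [x] at [0] in the shift on [D / N].  It is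
   the class of [x] modulo [C]. *)
Let A (j : int) := vset W (fun i => (i < j)%R).
Let B (j : int) := vset W (fun i => (j + p%:Z <= i)%R).
Let D := vset W (fun i => (i < 0)%R || (p.+1%:Z <= i)%R).
Let C := setmul (A 1%R) (B 0%R).
Let M : set G := [set x | forall j, setmul (A j) (B j) x].

Hypothesis Dp : vset W (fun i => (i < 0)%R || (p%:Z <= i)%R) `<=` N.

Let ABN j x : A j x -> B j x -> N x.
Proof.
move=> Ax Bx; apply: (star_sub_powE N_star (i := j)); apply: Dp => i /orP[ia|ib].
  by rewrite -sigma_powD; apply: Ax; lia.
by rewrite -sigma_powD; apply: Bx; lia.
Qed.

Let NA j : N `<=` A j. Proof. by move=> x; apply: vset_sub. Qed.
Let NB j : N `<=` B j. Proof. by move=> x; apply: vset_sub. Qed.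

Let sAB i j : is_subgroup (setmul (A i) (B j)).
Proof. exact: (setmul_subgroup (sV _) (sV _) (@nV _)). Qed.
Let nAB i j : is_normal (setmul (A i) (B j)).
Proof. exact: (is_normal_setmul (@nV _) (@nV _)). Qed.
Let cAB i j : closed (setmul (A i) (B j)).
Proof. exact: (closed_setmul cG hG (@cV _) (@cV _)). Qed.

Let ABshift i j l x : setmul (A i) (B j) (sigma_pow l x) ->
  setmul (A (i + l)%R) (B (j + l)%R) x.
Proof. by apply: setmul_vset_shift => k; lia. Qed.

Let ABshiftI i j l x : setmul (A (i + l)%R) (B (j + l)%R) x ->
  setmul (A i) (B j) (sigma_pow l x).
Proof.
move=> ABx; apply: (@setmul_vset_shift _ W (fun k => (k < i + l)%R)
  (fun k => (j + l + p%:Z <= k)%R) _ _ (- l)%R) => [k|k|]; [lia|lia|].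
by rewrite sigma_powK.
Qed.

Let M_star : is_star_subgroup M.
Proof.
split.
- have -> : M = \bigcap_(j in [set: int]) setmul (A j) (B j).
    by apply/seteqP; split=> x Mx j; [move=> _|]; exact: Mx.
  by apply: closed_bigI.
- split=> [j|x y Mx My j|x Mx j].
  + exact: (sub1 (sAB _ _)).
  + by apply: (subM (sAB _ _)); [exact: Mx|exact: My].
  + by apply: (subV (sAB _ _)); exact: Mx.
- move=> x; split=> Mx j.
    by have := ABshift (Mx (j - 1)%R : setmul _ _ (sigma_pow 1%:Z x)); rewrite subrK.
  by apply: (@ABshiftI j j 1%R); exact: Mx.
Qed.

Let nM : is_normal M.
Proof. by move=> x y Mx j; apply: nAB; exact: Mx. Qed.

Let DM : D `<=` M.
Proof.
move=> x Dx j; have [j0|j0] := leP j 0%R.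
  by apply: (setmul_subl (sV _)); apply: vset_sub Dx => i; lia.
by apply: (setmul_subr (sV _)); apply: vset_sub Dx => i; lia.
Qed.

(** In the shift on [D / N], an element of [D] has a trivial symbol at every place other than
    [0]. *)
Let DC l x : l != 0%R -> D x -> C (sigma_pow l x).
Proof.
move=> l0 Dx; have [j0|j0] := ltP l 0%R.
  by apply: (setmul_subl (sV _)); apply: vset_shiftI Dx => i; lia.
by apply: (setmul_subr (sV _)); apply: vset_shiftI Dx => i; lia.
Qed.

Let NM : N `<=` M.
Proof. by move=> x Nx; apply: DM; apply: vset_sub Nx. Qed.

Let MDC x : M x -> exists2 d, D d & C (d^-1 * x).
Proof.
move=> Mx; have [a0 Aa0 Ba0] := Mx 0%R; have [a1 Aa1 Ba1] := Mx 1%R.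
pose d := a1^-1 * a0; exists d.
  have Ad : A 0%R d.
    by apply: (subVM (sV _)) => //; apply: vset_sub Aa1 => i; lia.
  have Bd : B 1%R d.
    have -> : d = (a1^-1 * x) * (a0^-1 * x)^-1 by rewrite /d; gsimp.
    by apply: (subMV (sV _)) => //; apply: vset_sub Ba0 => i; lia.
  by move=> i /orP[i0|i1]; [apply: Ad|apply: Bd; lia].
(* With this first factor the second factor of [d^-1 * x] becomes [a0^-1 * x], which lies in
   [B 0]. *)
exists (a1 ^ d); first exact: (@nV _).
by rewrite /d; move: Ba0; gsimp.
Qed.

Let kernelE x : M x -> (N x <-> forall i, C (sigma_pow i x)).
Proof.
move=> Mx; split=> [Nx i|Cx].
  have Nix := star_sub_powI i N_star Nx.
  by apply: (setmul_subl (sV _)); exact: NA Nix.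
(* Trivial symbols merge the factorisations at consecutive places: by [ABN] their first factors
   agree modulo [N]. Letting [l] grow puts [x] in [B j], for every [j]. *)
have key l j : setmul (A (j + l%:Z)%R) (B j) x.
  elim: l => [|l [a Aa Ba]]; first by rewrite addr0; exact: Mx.
  have [a' Aa' Ba'] := ABshift (Cx (j + l%:Z)%R).
  exists a'; first by apply: vset_sub Aa' => i; lia.
  have Na : N (a'^-1 * a).
    apply: (@ABN (j + l%:Z)%R).
      by apply: (subVM (sV _)) => //; apply: vset_sub Aa' => i; lia.
    have -> : a'^-1 * a = (a'^-1 * x) * (a^-1 * x)^-1 by gsimp.
    by apply: (subMV (sV _)); [apply: vset_sub Ba'|apply: vset_sub Ba] => i; lia.
  have -> : a'^-1 * x = (a'^-1 * a) * (a^-1 * x) by gsimp.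
  by apply: (subM (sV _)) => //; exact: NB.
have BN j : B j x.
  have [|l|m n mn|l|y By Ay] := @setmul_chain G cG (B j) (fun l => A (j + l%:Z)%R) x.
  - exact: cV.
  - exact: cV.
  - by move=> y; apply: vset_sub => i; lia.
  - by apply: setmulC => //; exact: nV.
  have Ny : N (y^-1 * x).
    by move=> i _; apply: (Ay `|(i - j + 1)%R|.+1); lia.
  by rewrite -(mulVKg y x); apply: (subM (sV _)) => //; exact: NB.
by move=> i _; apply: (BN (i - p%:Z)%R); lia.
Qed.

Let sC : is_subgroup C. Proof. exact: sAB. Qed.
Let nC : is_normal C. Proof. exact: nAB. Qed.

(** Elements of [D] are trivial outside [p.+1] places, so modulo [N] they are determined by their
    class modulo the open subgroup [V]. *)
Let reps : exists s : seq G, forall x, M x ->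
  exists2 y, y \in s & D y /\ C (x^-1 * y).
Proof.
pose V := vset W (fun i => (0 <= i < p.+1%:Z)%R).
have [s sP] := finite_index cG (sV _ : is_subgroup V) (vset_nbhs 0 (Posz p.+1) W1).
pose r y := xget 1 [set d | D d /\ V (y^-1 * d)].
exists [seq r y | y <- s] => x Mx; have [d Dd Cdx] := MDC Mx.
have [y ys Vy] := sP d.
have [Dr Vr] : D (r y) /\ V (y^-1 * r y).
  by apply: (@xgetPex _ 1 [set d | D d /\ V (y^-1 * d)]); exists d.
exists (r y); [exact: map_f|split=> //].
have Ndr : N (d^-1 * r y).
  have Dyx : D (d^-1 * r y) by exact: (subVM (sV _)).
  move=> i _; have [i0|i0] := ltP i 0%R; first by apply: Dyx; rewrite i0.
  have [i1|i1] := leP (Posz p.+1) i; first by apply: Dyx; rewrite i1 orbT.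
  have -> : d^-1 * r y = (y^-1 * d)^-1 * (y^-1 * r y) by gsimp.
  by apply: (subVM (sV _) Vy Vr); lia.
have -> : x^-1 * r y = (d^-1 * x)^-1 * (d^-1 * r y) by gsimp.
apply: (subVM sC) => //; apply: (setmul_subl (sV _)); exact: NA.
Qed.

(** [F] is [M] modulo [M :&: C], represented by elements of [D]; the symbol of [x] at [i] is the
    class of [sigma_pow i x]. *)
Lemma homoclinic_shift x0 : D x0 -> ~ N x0 ->
  exists M' (F : finGroupType),
    [/\ is_star_subgroup M', is_normal M', N `<=` M', ~ open_in N M'
      & shift_factor M' N F].
Proof.
move=> Dx0 Nx0; have [cM sM _] := M_star; have sN : is_subgroup N := sV _.
have [s sP] := reps.
have [||x Mx|F [q [qM qC qS]]] := @finite_quotient G M (M `&` C) sM _ _ s.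
- exact: subgroupI.
- by move=> x y [Mx Cx] My; split; [exact: nM|exact: nC].
- have [y ys [Dy Cy]] := sP x Mx; exists y => //; split; first exact: DM.
  by split=> //; apply: (subVM sM) => //; exact: DM.
have Msig i x : M x -> M (sigma_pow i x) by exact: star_sub_powI.
have qC1 x : M x -> C x -> q x = 1 by move=> Mx Cx; apply/qC.
have q1 : q 1 = 1 by apply: qC1; exact: sub1.
have lift t : exists2 d, D d & q d = t.
  have [x Mx <-] := qS t; have [d Dd Cdx] := MDC Mx; exists d => //.
  have Md := DM Dd; have Mdx := subVM sM Md Mx.
  by rewrite -[in RHS](mulVKg d x) qM // (qC1 _ Mdx Cdx) mulg1.
pose t u := s2val (cid2 (lift u)).
have tD u : D (t u) by exact: (s2valP (cid2 (lift u))).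
have tq u : q (t u) = u by exact: (s2valP' (cid2 (lift u))).
exists M, F; split=> //.
  move=> /(open_in_sub sN NM sM)[O [oO NO MON]].
  have [n|m n mn x [Mx Vx]|||K KP] := @compact_chain_sub G cG
    (fun n => M `&` vset W (fun i => (- n%:Z <= i < n%:Z)%R)) O.
  - exact: closedI.
  - by split=> //; apply: vset_sub Vx => i; lia.
  - by [].
  - by move=> x xP; apply: NO => i _; have [_ Vx] := xP `|i|.+1; apply: Vx; lia.
  (* This shift moves the nontrivial places of [x0] to the left of the window from [- K] to [K], so
     openness would put [x0] in [N]. *)
  apply: Nx0; apply: (star_sub_powE N_star (i := (K%:Z + p.+1%:Z)%R)).
  apply: MON; first by apply: Msig; exact: DM.
  apply: KP; split; first by apply: Msig; exact: DM.
  by apply: vset_shiftI Dx0 => i; lia.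
exists (fun x i => q (sigma_pow i x)); split.
- by move=> x y i Mx My; rewrite sigma_powM qM //; exact: Msig.
- by move=> x i _; rewrite sigma_powD.
- move=> x Mx; split=> [/(kernelE Mx) Cx i|qx].
    by apply: qC1 => //; exact: Msig.
  by apply/kernelE => // i; have [] := (qC _ (Msig i _ Mx)).1 (qx i).
- move=> u.
  (* Finitely many symbols are prescribed by multiplying translates of representatives, each
     affecting one place only; compactness handles all places at once. *)
  have fin (L : seq int) : uniq L -> exists x, [/\ M x,
      forall i, i \in L -> C ((t (u i))^-1 * sigma_pow i x)
      & forall i, i \notin L -> C (sigma_pow i x)].
    elim: L => [_|i L IH /= /andP[iL /IH[x [Mx xL xnL]]]].
      exists 1; split=> // [|i _]; first exact: (sub1 sM).
      by rewrite sigma_pow_one; exact: (sub1 sC).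
    pose y := sigma_pow (- i)%R (t (u i)).
    have yi j : j != i -> C (sigma_pow j y).
      by move=> ji; rewrite -sigma_powD; apply: DC; rewrite ?subr_eq0.
    exists (x * y); split; first by apply: (subM sM) => //; apply/Msig/DM.
      move=> j; rewrite in_cons sigma_powM; have [->{j} _|ji /= jL] := eqVneq j i.
        rewrite sigma_powNK; have := nC (t (u i)) (xnL i iL).
        by gsimp.
      by rewrite mulgA; apply: (subM sC) => //; [exact: xL|exact: yi].
    move=> j; rewrite in_cons negb_or => /andP[ji jL]; rewrite sigma_powM.
    by apply: (subM sC) => //; [exact: xnL|exact: yi].
  pose X n : set G := M `&` [set x | forall i, (- n%:Z <= i < n%:Z)%R ->
     C ((t (u i))^-1 * sigma_pow i x)].
  have [n|m n mn x [Mx Xx]|n|x xP] := @compact_chain G cG X.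
  - apply: closedI => //.
    have -> : [set x | forall i, (- n%:Z <= i < n%:Z)%R ->
       C ((t (u i))^-1 * sigma_pow i x)] =
      \bigcap_(i in [set i : int | (- n%:Z <= i < n%:Z)%R])
        (fun x => (t (u i))^-1 * sigma_pow i x) @^-1` C.
      by apply/seteqP; split=> x Px i Pi; exact: Px.
    apply: closed_bigI => i _; apply: preimage_closed; last exact: cAB.
    by move=> x _; apply: continuous_mulg => ?; [exact: cvg_cst|exact: continuous_sigma_pow].
  - by split=> // i im; apply: Xx; lia.
  - have [|x [Mx xL _]] := fin [seq (k%:Z - n%:Z)%R | k <- iota 0 (n + n)].
      by rewrite map_inj_uniq ?iota_uniq // => k l; lia.
    exists x; split=> // i ni; apply: xL; apply/mapP.
    by exists `|(i + n%:Z)%R|%N; [rewrite mem_iota|]; lia.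
  have Mx := (xP 0%N).1; exists x => // i.
  have Cx : C ((t (u i))^-1 * sigma_pow i x) by apply: (xP `|i|.+1).2; lia.
  have Mt : M (t (u i)) by exact: DM.
  rewrite -(mulVKg (t (u i)) (sigma_pow i x)) qM ?tq ?qC1 ?mulg1 //.
    by apply: (subVM sM) => //; exact: Msig.
  by apply: (subVM sM) => //; exact: Msig.
(* Near [1] the finitely many closed nontrivial cosets of [C] represented in [s] are avoided, and
   then the class can only be trivial. *)
- exists [set x | forall y, y \in s -> ~ C y -> ~ C (y^-1 * x)].
    elim: s {sP} => [|y s IH]; first by apply: filterS filterT.
    have [Cy|nCy] := pselect (C y).
      by apply: filterS IH => x xs z; rewrite in_cons => /predU1P[->//|]; exact: xs.
    have nC1 : nbhs 1 [set x | ~ C (y^-1 * x)].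
      apply: open_nbhs_nbhs; split; last by rewrite /= mulg1 => /(subVE sC).
      have /closed_openC : closed [set x | C (y^-1 * x)]; last by [].
      apply: (@preimage_closed _ _ (fun x => y^-1 * x)); last exact: cAB.
      by move=> x _; exact: continuous_mull.
    apply: filterS (filterI nC1 IH) => x [nCx xs] z.
    by rewrite in_cons => /predU1P[->//|]; exact: xs.
  move=> x Mx xs; apply: qC1 => //.
  have [y ys [Dy Cy]] := sP x Mx.
  have Cyx : C (y^-1 * x) by have := subV sC Cy; gsimp.
  apply: contrapT => Cx; apply: (xs y) => // Cy'; apply: Cx.
  by rewrite -(mulVKg y x); exact: (subM sC).
Qed.

End HomoclinicShift.

(** * Refinement to simple factors *)

Lemma closed_of_open_in (G : topGroupType) (K H : set G) : is_subgroup K ->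
  is_subgroup H -> closed H -> K `<=` H -> open_in K H -> closed K.
Proof.
move=> sK sH cH KH [O O1 OK]; rewrite -[K]setCK; apply: open_closedC.
rewrite openE => z nKz; rewrite /interior.
have [Hz|nHz] := pselect (H z).
  have := @continuous_mull G z^-1 z O; rewrite mulVg => /(_ O1) /=.
  rewrite /nbhs /=; apply: filterS => y Ozy Ky; apply: nKz.
  have Kzy : K (z^-1 * y) by apply: OK => //; apply: subVM => //; exact: KH.
  by have := subMV sK Ky Kzy; gsimp.
have : nbhs z (~` H) by apply: open_nbhs_nbhs; split=> //; exact: closed_openC.
by apply: filterS => y nHy /KH.
Qed.

Section Towers.
Variable G : starGroupType.
Implicit Types (H K N : set G).

(** A relative series with simple shift factors, indexed from [0] and ending at any [N], so that
    towers can be concatenated. *)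
Definition tower H N := exists (r : nat) (Gs : nat -> set G) (Sg : nat -> finGroupType),
  [/\ Gs 0%N = H, Gs r = N, forall i, is_star_subgroup (Gs i)
    & forall i, (i < r)%N -> [/\ Gs i.+1 `<=` Gs i, simple [set: Sg i]%SET
        & shift_factor (Gs i) (Gs i.+1) (Sg i)]].

Lemma tower_refl H : is_star_subgroup H -> tower H H.
Proof. by move=> HH; exists 0%N, (fun=> H), (fun=> {perm bool} : finGroupType). Qed.

Lemma tower_step H K N (T : finGroupType) : is_star_subgroup H -> K `<=` H ->
  simple [set: T]%SET -> shift_factor H K T -> tower K N -> tower H N.
Proof.
move=> HH KH sT HK [r [Gs [Sg [G0 Gr GG GS]]]].
exists r.+1, (fun i => if i is j.+1 then Gs j else H),
  (fun i => if i is j.+1 then Sg j else T).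
split=> // [[|i]|[|i] ir] //; first by rewrite G0.
exact: GS.
Qed.

Lemma tower_trans H K N : tower H K -> tower K N -> tower H N.
Proof.
move=> [r]; elim: r H => [|r IH] H [Gs [Sg [G0 Gr GG GS]]] KN.
  by rewrite -G0 Gr.
have [G10 sS HK] := GS 0%N isT.
have H1 : tower (Gs 1%N) N.
  apply: IH => //; exists (Gs \o S), (Sg \o S).
  split=> [//|||i ir]; [exact: Gr|move=> i; exact: GG|exact: (GS i.+1 ir)].
by rewrite -G0; exact: (tower_step (GG 0%N) G10 sS HK H1).
Qed.

Lemma shift_factor_pow H N (T : finGroupType) (f : G -> int -> T) :
  is_star_subgroup H ->
  (forall x i, H x -> f (sigma x) i = f x (i + 1)%R) ->
  forall x i, H x -> f x i = f (sigma_pow i x) 0%R.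
Proof.
move=> HH fS.
have fD k x i : H x -> f (sigma_pow k x) i = f x (i + k)%R.
  move=> Hx; elim/int_rect: k i => [|n IH|n IH] i; first by rewrite addr0.
    have -> : sigma_pow n.+1%:Z x = sigma (sigma_pow n%:Z x) by [].
    by rewrite fS ?IH; [congr f; lia|exact: star_sub_powI].
  have sE : sigma_pow (- n%:Z)%R x = sigma (sigma_pow (- n.+1%:Z)%R x).
    by rewrite -sigma_powS; congr sigma_pow; lia.
  have := IH (i - 1)%R; rewrite sE fS ?subrK; last exact: star_sub_powI.
  by move=> ->; congr f; lia.
by move=> x i Hx; rewrite fD // add0r.
Qed.

(** For a maximal normal subgroup [M] of [T], let [K] be the elements with all symbols in [M]. Then
    [H / K] is the full shift on the simple group [T / M], and [K / N] is the full shift on the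
    smaller group [M]. *)
Lemma refine_tower (n : nat) (T : finGroupType) H N : (#|T| <= n)%N ->
  is_star_subgroup H -> is_star_subgroup N -> N `<=` H ->
  shift_factor H N T -> tower H N.
Proof.
elim: n T H N => [|n IH] T H N Tn HH NN NH HN.
  by have := max_card (pred1 (1 : T)); rewrite card1 => /leq_trans/(_ Tn).
have [cH sH iH] := HH; have [f [fM fS fK fsurj [O O1 fO]]] := HN.
have [T1|ntT] := eqVneq [set: T]%SET 1%G.
  have -> : N = H; last exact: tower_refl.
  apply/seteqP; split=> // x Hx; apply/fK => // i.
  by have := finset.in_setT (f x i); rewrite T1 => /set1gP.
have [M maxM] := ex_maxnormal_ntrivg ntT.
have nMT := maxnormal_normal maxM.
pose K : set G := H `&` [set x | forall i, f x i \in M].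
have f1 i : f 1 i = 1.
  by apply: (mulgI (f 1 i)); rewrite -fM ?mulg1 //; exact: sub1.
have fV x i : H x -> f x^-1 i = (f x i)^-1.
  move=> Hx; apply: (mulgI (f x i)); rewrite -fM ?mulgV ?f1 //; exact: subV.
have KK : is_star_subgroup K.
  split.
  - have -> : K = \bigcap_(i in [set: int]) (H `&` [set x | f x i \in M]).
      apply/seteqP; split=> x Kx; first by move=> i _; split; [exact: Kx.1|exact: Kx.2].
      by split; [exact: (Kx 0%R I).1|move=> i; exact: (Kx i I).2].
    (* A condition on a single symbol defines an open, hence closed, subgroup of [H]. *)
    apply: closed_bigI => i _; apply: (closed_of_open_in _ sH cH).
    + split; first by split; [exact: sub1|rewrite /= f1 group1].
      * move=> x y [Hx Mx] [Hy My]; split; first exact: subM.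
        by rewrite /= fM // groupM.
      * by move=> x [Hx Mx]; split; [exact: subV|rewrite /= fV // groupV].
    + by move=> x [].
    + exists (@sigma_pow G i @^-1` O).
        by apply: (@continuous_sigma_pow G i 1 O); rewrite sigma_pow_one.
      move=> x Hx Ox; split=> //=; rewrite (shift_factor_pow N HH fS) //.
      by rewrite fO ?group1 //; exact: star_sub_powI.
  - split; first by split=> [|i]; [exact: sub1|rewrite f1 group1].
      move=> x y [Hx Mx] [Hy My]; split=> [|i]; first exact: subM.
      by rewrite fM // groupM.
    by move=> x [Hx Mx]; split=> [|i]; [exact: subV|rewrite fV // groupV].
  - move=> x; split=> [[/iH Hx Mx]|[Hx Mx]].
      split=> // i; rewrite /= -(subrK 1%R i) -fS //; exact: Mx.
    by split; [exact/iH|move=> i; rewrite /= fS //; exact: Mx].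
have NK : N `<=` K.
  by move=> x Nx; split=> [|i]; [exact: NH|rewrite (fK x _).1 // ?group1 //; exact: NH].
apply: (@tower_step H K N (coset_of M)) => //.
- by move=> x [].
- by rewrite -quotientT quotient_simple.
- exists (fun x i => coset M (f x i)).
  have MN t : t \in 'N(M)%g.
    by apply: (fintype.subsetP (normal_norm nMT)); rewrite finset.in_setT.
  split.
  + by move=> x y i Hx Hy; rewrite fM // morphM.
  + by move=> x i Hx; rewrite fS.
  + move=> x Hx; split=> [[_ Mx] i|Mx]; first by rewrite coset_id.
    by split=> // i; rewrite coset_idr.
  + move=> s; have [x Hx fx] := fsurj (fun i => fingroup.repr (s i)).
    by exists x => // i; rewrite fx coset_reprK.
  + by exists O => // x Hx Ox; rewrite fO // morph1.
- apply: (IH (subg_of M)) => //.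
    rewrite -ltnS -cardsT -(card_isog (isog_subg M)); apply: leq_trans Tn.
    by rewrite -[#|T|]cardsT; apply: proper_card; exact: maxnormal_proper maxM.
  exists (fun x i => subg M (f x i)); split.
  + by move=> x y i [Hx Mx] [Hy My]; rewrite fM // subgM.
  + by move=> x i [Hx _]; rewrite fS.
  + move=> x [Hx Mx]; split=> [Nx i|Mx1]; first by rewrite (fK x _).1 // morph1.
    by apply/fK => // i; rewrite -(@subgK _ _ _ (Mx i)) Mx1.
  + move=> s; have [x Hx fx] := fsurj (fun i => sgval (s i)).
    exists x => [|i]; last by rewrite fx sgvalK.
    by split=> // i; rewrite fx subgP.
  + by exists O => // x [Hx Mx] Ox; rewrite fO // morph1.
Qed.

End Towers.

(** * Existence *)

Section TowerExistence.
Variables (G : starGroupType) (U : set G).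
Hypotheses (cG : compact [set: G]) (hG : hausdorff_space G).
Hypotheses (sU : is_subgroup U) (nU : is_normal U) (U1 : nbhs 1 U).
Hypothesis expU : forall x : G, (forall i, U (sigma_pow i x)) -> x = 1.

Let cU : closed U. Proof. exact: closed_subgroup. Qed.
Let sV P : is_subgroup (vset U P). Proof. exact: vset_subgroup. Qed.
Let nV P : is_normal (vset U P). Proof. exact: vset_normal. Qed.
Let cV P : closed (vset U P). Proof. exact: vset_closed. Qed.

(* In other words, [G / N] is expansive. *)
Lemma normal_star_core (N : set G) : is_star_subgroup N -> is_normal N ->
  exists W, [/\ is_subgroup W, is_normal W, nbhs 1 W & vset W predT = N].
Proof.
move=> NN nN; have [cN sN _] := NN.
have [k kP] := gluing_interval cG sU nU U1 NN.
pose V n := vset U (fun j => (- n%:Z <= j < n%:Z)%R).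
exists (setmul (vset U (fun j => (0 <= j < k%:Z)%R)) N); split.
- exact: (setmul_subgroup (sV _) sN (@nV _)).
- exact: (is_normal_setmul (@nV _) nN).
- by apply: filterS (setmul_subl sN) (vset_nbhs 0 (Posz k) U1).
apply/seteqP; split=> x; last first.
  by move=> Nx i _; apply: (setmul_subr (sV _)); exact: star_sub_powI.
(* Gluing the conditions at all places puts [x] in [N] times each cylinder [V n]; by expansiveness
   these cylinders shrink to [1]. *)
move=> Wx; have NVx n : setmul N (V n) x.
  apply: (setmulC (@nV _)).
  have := kP (- n%:Z)%R (n + n)%N x (fun i _ => Wx _ isT).
  by case=> u Vu Nu; exists u => //; apply: vset_sub Vu => i; lia.
have [|y Ny Vy] := setmul_chain cG cN (fun n => @cV _) _ NVx.
  by move=> m n mn y; apply: vset_sub => i; lia.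
suff <- : y = x by [].
rewrite -[RHS](mulVKg y) (expU (x := y^-1 * x)) ?mulg1 // => i.
by apply: (Vy `|i|.+1); lia.
Qed.

Lemma tower_exists : exists G1, [/\ is_star_subgroup G1, is_normal G1, nbhs 1 G1
  & tower G1 [set (1 : G)]].
Proof.
have [F [q [_ qU _]]] := open_quotient cG sU nU U1.
(* For [lt0] and [gt0]: the symbols at place [0] in [N] that follow, or precede, an infinite trivial
   run. *)
pose K (P : pred int) (N : set G) :=
  [set t : F | `[< exists2 x, (N `&` vset U P) x & q x = t >]]%SET.
pose lt0 : pred int := fun i => (i < 0)%R.
pose gt0 : pred int := fun i => (0 < i)%R.
have KS P N M : N `<=` M -> K P N \subset K P M.
  move=> NM; apply/fintype.subsetP => t; rewrite !finset.inE => /asboolW[x [Nx Vx] qx].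
  by apply/asboolP; exists x => //; split=> //; exact: NM.
have KE P N M x : N `<=` M -> K P N = K P M -> M x -> vset U P x ->
    exists y, [/\ N y, M y, vset U P y & U (y^-1 * x)].
  move=> NM KNM Mx Vx; have : q x \in K P N.
    by rewrite KNM finset.inE; apply/asboolP; exists x.
  rewrite finset.inE => /asboolW[y [Ny Vy] /qU Uyx].
  by exists y; split=> //; exact: NM.
(* Induction on the room left for the two sets of symbols to grow, each having at most [#|F|]
   elements. *)
suff key n N : is_star_subgroup N -> is_normal N ->
    (#|F| + #|F| < n + (#|K lt0 N| + #|K gt0 N|))%N ->
    exists G1, [/\ is_star_subgroup G1, is_normal G1, nbhs 1 G1 & tower G1 N].
  apply: (key (#|F| + #|F|).+1); first exact: is_star_subgroup1.
    by move=> x y ->; rewrite conj1g.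
  by rewrite addSn ltnS leq_addr.
elim: n N => [|n IH] N NN nN.
  by rewrite add0n ltnNge leq_add ?max_card.
move=> Kn; have [W [sW nW W1 WN]] := normal_star_core NN nN.
have [noD|] := pselect (forall m : nat,
    vset W (fun i => (i < 0)%R || (m%:Z <= i)%R) `<=` vset W predT).
  exists N; split=> //; last exact: tower_refl.
  by rewrite -WN; exact: open_of_no_homoclinic.
move=> /existsNP nD.
pose R m := `[< ~ (vset W (fun i => (i < 0)%R || (m%:Z <= i)%R) `<=` vset W predT) >].
have exR : exists m, R m by have [m nDm] := nD; exists m; apply/asboolP.
(* The minimal length is positive, since length [0] already imposes triviality at every place. *)
case: (ex_minnP exR) => -[|p] /asboolP nDp minp.
  by case: nDp => x; apply: vset_sub => i _; lia.
have Dp : vset W (fun i => (i < 0)%R || (p%:Z <= i)%R) `<=` vset W predT.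
  by apply: contrapT => nDp'; have := minp p (asboolT nDp'); rewrite ltnn.
have [x0 [Dx0 Nx0]] : exists x0, vset W (fun i => (i < 0)%R || (p.+1%:Z <= i)%R) x0 /\
    ~ vset W predT x0.
  apply: contrapT => no; apply: nDp => x Dx; apply: contrapT => Nx.
  by apply: no; exists x.
have := homoclinic_shift cG hG sW nW W1 Dp Dx0 Nx0.
rewrite WN => -[M [S [MM nM NM nNM MN]]].
have [|G1 [GG nG1 G1n tG]] := IH M MM nM.
  have leK P : (#|K P N| <= #|K P M|)%N by apply/subset_leq_card/KS.
  (* If neither set grew, [open_in_of_equal_ends] would make [N] open in [M]. *)
  have : (#|K lt0 N| != #|K lt0 M|) || (#|K gt0 N| != #|K gt0 M|).
    rewrite -negb_and; apply/negP => /andP[/eqP e1 /eqP e2]; apply: nNM.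
    have eqK P : #|K P N| = #|K P M| -> K P N = K P M.
      by move=> e; apply/eqP; rewrite eqEcard KS //= e.
    apply: (open_in_of_equal_ends cG sU nU U1 expU NN MM) => x Mx Vx.
      by apply: (KE lt0) => //; exact: eqK.
    by apply: (KE gt0) => //; exact: eqK.
  by have := leK lt0; have := leK gt0; lia.
exists G1; split=> //; apply: tower_trans tG _.
exact: (refine_tower (leqnn _) MM NN NM MN).
Qed.

End TowerExistence.

(** * Quotients isomorphic to full shifts *)

Section StarSubgroups.
Variable G : starGroupType.

Lemma starSubgroup_star (H : starSubgroup G) : is_star_subgroup (H : set G).
Proof.
split; first exact: star_closed.
- have gH := star_group_closed H; split.
  + by have [/set_mem] := gH.
  + by move=> x y /mem_set Hx /mem_set Hy; apply/set_mem/(group_closedM gH).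
  + by move=> x /mem_set Hx; apply/set_mem/(group_closedV gH).
- move=> x; split=> [/mem_set/mem_sigmaV/set_mem|/mem_set/mem_sigma/set_mem //].
  by rewrite sigmaK.
Qed.

Lemma starSubgroup_of (A : set G) : is_star_subgroup A ->
  exists H : starSubgroup G, (H : set G) = A.
Proof.
move=> [cA sA iA].
have gA : monoid.group_closed (mem A).
  split; first by apply: mem_set; exact: sub1 sA.
  by move=> x y /set_mem Ax /set_mem Ay; apply: mem_set; exact: subMV sA Ax Ay.
have sgA : sigma @` A = A.
  apply/seteqP; split=> [_ [x Ax <-]|x Ax]; first exact/iA.
  by exists (sigmaV x); [apply/iA; rewrite sigmaVK|rewrite sigmaVK].
by exists (StarSubgroup cA gA sgA).
Qed.

Variable H : starSubgroup G.

Definition to_sub (x : G) (Hx : (H : set G) x) : subgroup_type H :=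
  Sub x (mem_set Hx).

Lemma val_to_sub x (Hx : (H : set G) x) : val (to_sub Hx) = x.
Proof. exact: SubK. Qed.

Lemma sub_val_in (x : subgroup_type H) : (H : set G) (val x).
Proof. exact/set_mem/valP. Qed.

Lemma nbhs_subgroup (x : subgroup_type H) (A : set (subgroup_type H)) :
  nbhs x A -> exists2 V : set G, nbhs (val x) V & forall y, V (val y) -> A y.
Proof.
rewrite nbhsE => -[_ [[V oV <-] Vx] VA].
by exists V; [apply: open_nbhs_nbhs; split|move=> y Vy; exact: VA].
Qed.

Lemma compact_subgroup : compact [set: G] -> compact [set: subgroup_type H].
Proof.
move=> cG; apply/compact_near_coveringP => I F P FF cov.
have cH : compact (H : set G) by exact: subclosed_compact (star_closed H) cG _.
have /compact_near_coveringP covH := cH.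
have : \near F, (H : set G) `<=` (fun y => forall Hy : (H : set G) y, P F (to_sub Hy)).
  apply: (covH I F (fun i y => forall Hy : (H : set G) y, P i (to_sub Hy))) => x Hx.
  have [[A B] /= [Ax FB] AB] := cov (to_sub Hx) Logic.I.
  have [V Vx VA] := nbhs_subgroup Ax.
  exists (V, B); first by split=> //; rewrite val_to_sub in Vx.
  move=> [y i] /= [Vy Bi] Hy; apply: (AB (to_sub Hy, i)); split=> //=.
  by apply: VA; rewrite val_to_sub.
apply: filterS => i Pi x _.
have := Pi (val x) (sub_val_in x) (sub_val_in x).
by congr (P i _); apply: val_inj; rewrite val_to_sub.
Qed.

End StarSubgroups.

Section ShiftFactors.
Variables (G : starGroupType) (H N : starSubgroup G) (T : finGroupType).

Local Notation R := (relative_subgroup H N).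

Lemma shift_factor_of_isom (nN : normal_subgroup R) :
  star_isomorphic (Defs.quotient_group nN) (full_shift T) ->
  shift_factor H N T.
Proof.
move=> [phi [psi [phiM [phiK psiK] cphi cpsi phiS]]].
have HH := starSubgroup_star H; have [_ sH iH] := HH.
pose pi (x : subgroup_type H) : Defs.quotient_group nN :=
  \pi_(Defs.quotient_group nN)%qT x.
(* The coordinates of the image of [x] under [phi], with default [1] outside [H]. *)
pose f (x : G) (i : int) : T :=
  if pselect ((H : set G) x) is left Hx then (phi (pi (to_sub Hx)) : int -> T) i else 1.
have fE x (Hx : (H : set G) x) i : f x i = (phi (pi (to_sub Hx)) : int -> T) i.
  rewrite /f; case: pselect => // Hx'.
  by congr ((phi (pi _) : int -> T) i); apply: val_inj.
have phi1 : phi 1 = 1 by apply: (mulgI (phi 1)); rewrite -phiM !mulg1.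
have piM x y : pi (x * y) = pi x * pi y by exact: quo_piM.
have pi1 : pi 1 = 1 by [].
exists f; split.
- move=> x y i Hx Hy; rewrite (fE _ (subM sH Hx Hy)) !fE.
  have -> : to_sub (subM sH Hx Hy) = to_sub Hx * to_sub Hy by apply: val_inj.
  by rewrite piM phiM.
- move=> x i Hx; have Hsx : (H : set G) (sigma x) by exact/iH.
  rewrite !fE; have -> : to_sub Hsx = sigma (to_sub Hx) by apply: val_inj.
  have -> : pi (sigma (to_sub Hx)) = sigma (pi (to_sub Hx)).
    by apply/esym; exact: quo_sigmaE.
  by rewrite phiS.
- move=> x Hx; split=> [Nx i|fx].
    rewrite (fE _ Hx); have -> : pi (to_sub Hx) = 1; last by rewrite phi1.
    apply/esym/(Defs.cosetP nN)/coset_relP; rewrite invg1 mul1g; exact: Nx.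
  have : pi 1 = pi (to_sub Hx).
    rewrite pi1; apply: (can_inj phiK); rewrite phi1; apply/funext => i.
    by rewrite -fE fx.
  by move=> /(Defs.cosetP nN)/coset_relP; rewrite invg1 mul1g.
- move=> s; pose x := generic_quotient.repr (psi (s : full_shift T)).
  exists (val x); first exact: sub_val_in.
  move=> i; rewrite (fE _ (sub_val_in x)).
  have -> : to_sub (sub_val_in x) = x by apply: val_inj.
  by rewrite /pi reprK psiK.
- have := @shift_proj T 1 0%R; rewrite -{1}phi1 -{1}pi1 => /cphi /=.
  move=> /(@quo_pi_continuous _ _ nN 1) /=.
  move=> /nbhs_subgroup[V V1 VP]; exists V => // x Hx Vx; rewrite fE.
  by have := VP (to_sub Hx); rewrite val_to_sub => /(_ Vx) /=.
Qed.

Hypotheses (cG : compact [set: G]).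

Lemma full_shift_hausdorff : hausdorff_space (full_shift T).
Proof. by apply: hausdorff_product => _; exact: discrete_hausdorff. Qed.

(** The coordinate map induces a continuous bijective morphism [phi]; its inverse is continuous
    because the quotient is compact and the full shift is Hausdorff. *)
Lemma isom_of_shift_factor : (N : set G) `<=` H -> shift_factor H N T ->
  exists nN : normal_subgroup R,
    star_isomorphic (Defs.quotient_group nN) (full_shift T).
Proof.
move=> NH [f [fM fS fK fsurj [O O1 fO]]].
have HH := starSubgroup_star H; have [_ sH iH] := HH.
have NN := starSubgroup_star N; have [_ sN _] := NN.
have f1 i : f 1 i = 1.
  by apply: (mulgI (f 1 i)); rewrite -fM ?mulg1 //; exact: sub1.
have fV x i : (H : set G) x -> f x^-1 i = (f x i)^-1.
  move=> Hx; apply: (mulgI (f x i)); rewrite -fM ?mulgV ?f1 //; exact: subV.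
have nN : normal_subgroup R.
  move=> x y Nx; have Hx := sub_val_in x; have Hy := sub_val_in y.
  suff : (N : set G) ((val y)^-1 * (val x * val y)) by [].
  apply/fK; first by apply: subVM => //; exact: subM.
  move=> i; rewrite !fM ?fV //; do ?[exact: subV|exact: subM].
  by rewrite ((fK _ Hx).1 Nx) mul1g mulVg.
exists nN; pose Q := Defs.quotient_group nN.
pose phi0 (x : subgroup_type H) : full_shift T := f (val x).
pose phi (x : Q) : full_shift T := phi0 (generic_quotient.repr x).
have phiE (x : subgroup_type H) : phi (\pi_Q%qT x) = phi0 x.
  set y := generic_quotient.repr (\pi_Q%qT x).
  have : \pi_Q%qT y = \pi_Q%qT x by rewrite /y reprK.
  move=> /(Defs.cosetP nN)/coset_relP Nyx; apply/funext => i.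
  have Hx := sub_val_in x; have Hy := sub_val_in y.
  have := (fK _ (subVM sH Hy Hx)).1 Nyx i.
  rewrite fM ?fV //; last exact: subV.
  by rewrite /phi /phi0 -/y => /mulg1_eq; rewrite invgK.
have phiM : {morph phi : x y / x * y}.
  elim/quo_ind=> x; elim/quo_ind=> y; rewrite -quo_piM !phiE.
  by apply/funext => i; rewrite /phi0 fM //; exact: sub_val_in.
have phi_inj : injective phi.
  elim/quo_ind=> x; elim/quo_ind=> y; rewrite !phiE => exy.
  have Hx := sub_val_in x; have Hy := sub_val_in y.
  apply/(Defs.cosetP nN)/coset_relP.
  suff : (N : set G) ((val x)^-1 * val y) by [].
  apply/fK => [|i]; first exact: subVM.
  rewrite fM ?fV //; last exact: subV.
  have := congr1 (fun g : full_shift T => (g : int -> T) i) exy.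
  by rewrite /phi0 => ->; rewrite mulVg.
have phi_surj s : exists x, phi x = s.
  have [x Hx fx] := fsurj s; exists (\pi_Q%qT (to_sub Hx)).
  by rewrite phiE; apply/funext => i; rewrite /phi0 val_to_sub.
pose psi s := projT1 (cid (phi_surj s)).
have psiK : cancel psi phi by move=> s; rewrite /psi; case: cid.
have phiK : cancel phi psi by move=> x; apply: phi_inj; rewrite psiK.
have cphi : continuous phi.
  apply: quo_continuous => x; apply: shift_cvg => n.
  have Hx := sub_val_in x.
  have Ox : nbhs (val x) [set y | O (sigma_pow n ((val x)^-1 * y))].
    apply: (@continuous_comp _ _ _ (fun y => (val x)^-1 * y) (@sigma_pow G n)
      (val x) _ _ O).
    - exact: continuous_mull.
    - exact: continuous_sigma_pow.
    - by rewrite /= mulVg sigma_pow_one.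
  have {}Ox : nbhs x [set y | O (sigma_pow n ((val x)^-1 * val y))].
    exact: (@subgroup_val_continuous G H x _ Ox).
  apply: filterS Ox => y /= Oy; rewrite !phiE /phi0.
  have Hy := sub_val_in y; have Hxy := subVM sH Hx Hy.
  have := fO _ (star_sub_powI n HH Hxy) Oy.
  rewrite -(shift_factor_pow N HH fS) // fM ?fV //; last exact: subV.
  by move=> /mulg1_eq; rewrite invgK.
exists phi, psi; split=> //.
- apply/continuousP => A oA.
  have -> : psi @^-1` A = ~` (phi @` (~` A)).
    apply/seteqP; split=> s /= As.
      by move=> [x nAx xs]; apply: nAx; rewrite -(phiK x) xs.
    by apply: contrapT => nAs; apply: As; exists (psi s).
  apply: closed_openC; apply: compact_closed; first exact: full_shift_hausdorff.
  apply: continuous_compact; first exact: continuous_subspaceT.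
  apply: (subclosed_compact (open_closedC oA) _ (@subsetT _ _)).
  have -> : [set: Q] = (\pi_Q%qT : subgroup_type H -> Q) @` [set: subgroup_type H].
    apply/seteqP; split=> // x _; exists (generic_quotient.repr x) => //; exact: reprK.
  apply: continuous_compact; last exact: compact_subgroup.
  by apply: continuous_subspaceT => x; exact: quo_pi_continuous.
- elim/quo_ind=> x.
  have -> : sigma (\pi_Q%qT x : Q) = \pi_Q%qT (sigma x) by exact: quo_sigmaE.
  rewrite !phiE; apply/funext => i; rewrite /phi0 /=.
  by rewrite fS //; exact: sub_val_in.
Qed.

End ShiftFactors.

(** * Composition multiplicities *)

Section Multiplicity.
Variable S : finGroupType.

(** The multiplicity of [S] among the composition factors of [K], independent of the chosen series
    by Jordan-Hölder. *)
Definition mult (gT : finGroupType) (K : {group gT}) : nat :=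
  count (fun s : section gT => [set: S]%SET \isog s)
    (mkfactors K (xchoose (exists_comps K))).

Lemma mult_comps (gT : finGroupType) (K : {group gT}) (s : seq {group gT}) :
  comps K s ->
  mult K = count (fun s : section gT => [set: S]%SET \isog s) (mkfactors K s).
Proof.
move=> Ks; apply: (seq.permP (JordanHolderUniqueness _ Ks)).
exact: xchooseP (exists_comps K).
Qed.

Lemma mult_quotient_simple (gT : finGroupType) (K N : {group gT}) :
  N <| K -> simple (K / N)%g ->
  mult K = (mult N + ([set: S]%SET \isog (K / N)%g))%N.
Proof.
move=> nN; rewrite quotient_simple // => maxN.
have Ns := xchooseP (exists_comps N).
have Ks : comps K (N :: xchoose (exists_comps N)).
  by move: Ns; rewrite /comps /= maxN.
rewrite (mult_comps Ks) /= addnC; congr (_ + _)%N.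
by congr (nat_of_bool _); apply: isog_transr; exact: section_reprP.
Qed.

(** Induction through a maximal normal subgroup of [K] above [N]: each step adds at most one factor
    [S] and strictly increases the index. *)
Lemma mult_bounds (gT : finGroupType) (K N : {group gT}) : N <| K ->
  (mult N <= mult K <= mult N + #|K : N|)%N.
Proof.
move: {2}#|K : N| (leqnn #|K : N|) => n; elim: n K => [|n IH] K.
  by rewrite leqn0 => /eqP iK; have := indexg_gt0 K N; rewrite iK.
move=> Kn nN; have [->|nKN] := eqVneq N K; first by rewrite leqnn leq_addr.
have [pN nKN'] : (N \proper K) /\ (K \subset 'N(N))%g.
  by move: nN => /andP[sNK ->]; rewrite finset.properEneq sNK andbT.
have [M maxM NM] := @maxgroup_exists _
  (fun G : {group gT} => (G \proper K) && (K \subset 'N(G))%g) N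
  (introT andP (conj pN nKN')).
have nMK : M <| K := maxnormal_normal maxM.
have sMK : M \proper K := maxnormal_proper maxM.
have nNM : N <| M by apply: normalS nN => //; exact: normal_sub.
have idx : (#|M : N| < #|K : N|)%N.
  rewrite -(@ltn_pmul2l #|N|) ?cardG_gt0 // !Lagrange ?proper_card //.
  exact: normal_sub.
have /andP[lo hi] := IH M (leq_trans idx Kn) nNM.
rewrite (mult_quotient_simple nMK) ?quotient_simple //.
rewrite (leq_trans lo (leq_addr _ _)) /=.
apply: leq_trans (leq_add hi (leq_b1 _)) _.
by rewrite -addnA leq_add2l addn1.
Qed.

(** Modulo [N] the map [h] is a surjective morphism from [T] to [K / N]; as [T] is simple, it is
    trivial or an isomorphism. *)
Lemma mult_step (gT T : finGroupType) (K N : {group gT}) (h : T -> gT) :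
  simple [set: T]%SET -> N <| K -> (forall t, h t \in K) ->
  (forall t u, (h (t * u))^-1 * (h t * h u) \in N) ->
  (forall x, x \in K -> exists t, x^-1 * h t \in N) ->
  mult K = (mult N + ((N != K) && ([set: S]%SET \isog [set: T]%SET)))%N.
Proof.
move=> sT nN hK hM hS; have [->|nNK] := eqVneq N K; first by rewrite addn0.
have nNx x : x \in K -> x \in 'N(N)%g by apply: (fintype.subsetP (normal_norm nN)).
have cosetE x y : x \in K -> y \in K -> x^-1 * y \in N -> coset N x = coset N y.
  move=> Kx Ky Nxy; have /mulg1_eq : (coset N x)^-1 * coset N y = 1.
    by rewrite -morphV ?nNx // -morphM ?groupV ?nNx //; exact: coset_id.
  by rewrite invgK.
pose g t := coset N (h t).
have gM : {in [set: T]%SET &, {morph g : x y / x * y}}.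
  move=> t u _ _; rewrite /g -morphM ?nNx //; apply: cosetE => //.
  by rewrite groupM.
pose gm := Morphism gM.
have gim : (gm @* [set: T]%SET)%g = (K / N)%g.
  apply/finset.setP => x; apply/morphimP/idP => [[t _ _ ->]|/morphimP[y _ Ky ->]].
    by apply: mem_morphim; [exact: nNx|exact: hK].
  have [t Nt] := hS y Ky; exists t; rewrite ?finset.in_setT //.
  exact: cosetE.
have kN : ('ker gm <| [set: T]%SET)%g by exact: ker_normal.
have /simpleP[_ /(_ _ kN) [k1|kT]] := sT; last first.
  case/negP: nNK; rewrite -val_eqE finset.eqEsubset normal_sub //=.
  rewrite -quotient_sub1 ?normal_norm // -gim.
  apply/fintype.subsetP => _ /morphimP[t _ _ ->].
  have tk : t \in ('ker gm)%g by rewrite kT finset.in_setT.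
  by rewrite (mker tk) group1.
have Tiso : [set: T]%SET \isog (K / N)%g.
  by rewrite -gim; apply/isogP; exists gm => //; exact/trivgP.
rewrite (mult_quotient_simple nN) -?(isog_simple Tiso) //.
by congr (_ + nat_of_bool _)%N; apply: isog_transr; rewrite isog_sym.
Qed.

End Multiplicity.

(** Each group is replaced by the first index of an isomorphic one in the joint list [E]. Equal
    counts make the two lists of indices permutations of each other. *)
Lemma perm_of_counts (m m' : nat) (A B : nat -> finGroupType) :
  (forall S : finGroupType, (\sum_(i < m) ([set: S]%SET \isog [set: A i]%SET) =
    \sum_(i < m') ([set: S]%SET \isog [set: B i]%SET))%N) ->
  m = m' /\ exists s : {perm 'I_m}, forall i : 'I_m,
    [set: A i]%SET \isog [set: B (s i)]%SET.
Proof.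
move=> cAB; pose E j := if (j < m)%N then A j else B (j - m)%N.
have EA i : (i < m)%N -> E i = A i by move=> im; rewrite /E im.
have EB i : E (m + i)%N = B i by rewrite /E ltnNge leq_addr /= addKn.
pose rep j := find (fun k => [set: E k]%SET \isog [set: E j]%SET) (iota 0 (m + m')).
have repE i j : (j < m + m')%N ->
    (rep i == rep j) = ([set: E j]%SET \isog [set: E i]%SET).
  move=> jm; apply/eqP/idP => [ij|ij]; last first.
    by apply: eq_find => k; rewrite /=; apply/esym; exact: isog_transr.
  have hj : has (fun k => [set: E k]%SET \isog [set: E j]%SET) (iota 0 (m + m')).
    by apply/hasP; exists j; [rewrite mem_iota|exact: isog_refl].
  have rj := nth_find 0%N hj; rewrite -/(rep j) in rj.
  have hi : has (fun k => [set: E k]%SET \isog [set: E i]%SET) (iota 0 (m + m')).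
    rewrite has_find -/(rep i) ij /rep -has_find; exact: hj.
  have ri := nth_find 0%N hi; rewrite -/(rep i) ij in ri.
  by apply: isog_trans ri; rewrite isog_sym.
pose lA := [seq rep j | j <- iota 0 m].
pose lB := [seq rep (m + j)%N | j <- iota 0 m'].
have cA j : (j < m + m')%N -> count_mem (rep j) lA =
    (\sum_(i < m) ([set: E j]%SET \isog [set: A i]%SET))%N.
  move=> jm; rewrite count_map -sum1_count big_mkcond -[X in iota 0 X]subn0 big_mkord.
  apply: eq_bigr => i _; by rewrite /= repE // (EA i).
have cB j : (j < m + m')%N -> count_mem (rep j) lB =
    (\sum_(i < m') ([set: E j]%SET \isog [set: B i]%SET))%N.
  move=> jm; rewrite count_map -sum1_count big_mkcond -[X in iota 0 X]subn0 big_mkord.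
  by apply: eq_bigr => i _; rewrite /= repE // EB.
have pAB : perm_eq lA lB.
  apply/allP => x; rewrite mem_cat => xAB.
  have [j jm ->] : exists2 j, (j < m + m')%N & x = rep j.
    move: xAB => /orP[] /mapP[j]; rewrite mem_iota /= add0n => jm ->.
      by exists j => //; apply: leq_trans jm (leq_addr _ _).
    by exists (m + j)%N; rewrite ?ltn_add2l.
  by rewrite /= cA // cB // cAB.
have mm : m = m'.
  by have := perm_size pAB; rewrite !size_map !size_iota.
split=> //; subst m'.
pose t := [tuple rep (m + i)%N | i < m].
have lBt : lB = t.
  apply: (@eq_from_nth _ 0%N) => [|i]; rewrite size_map size_iota ?size_tuple // => im.
  rewrite (nth_map 0%N) ?size_iota // nth_iota // add0n.
  by rewrite -(tnth_nth 0%N t (Ordinal im)) tnth_mktuple.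
move: pAB; rewrite lBt => /tuple_permP[s sP]; exists s => i.
have : nth 0%N lA i = rep (m + s i)%N.
  by rewrite sP -(tnth_nth 0%N _ i) !tnth_mktuple.
rewrite (nth_map 0%N) ?size_iota // nth_iota // add0n => /eqP.
by rewrite repE ?ltn_add2l // EB EA // isog_sym.
Qed.

(** * Images of subgroups in a finite group *)

Section Images.
Variables (G : groupType) (F : finGroupType) (q : G -> F).
Hypothesis qM : {morph q : x y / x * y}.

(* Taking the generated subgroup only provides the group structure, see [imgP]. *)
Definition img (A : set G) : {group F} :=
  <<[set t : F | `[< exists2 x, A x & q x = t >]]%SET>>%G.

Lemma morph1q : q 1 = 1.
Proof. by apply: (mulgI (q 1)); rewrite -qM !mulg1. Qed.

Lemma morphVq x : q x^-1 = (q x)^-1.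
Proof. by apply: (mulgI (q x)); rewrite -qM !mulgV morph1q. Qed.

Lemma imgP (A : set G) t : is_subgroup A ->
  reflect (exists2 x, A x & q x = t) (t \in img A).
Proof.
move=> sA; rewrite /= gen_set_id; first by rewrite finset.inE; exact: asboolP.
apply/group_setP; split.
  by rewrite finset.inE; apply/asboolP; exists 1; [exact: sub1|exact: morph1q].
move=> t1 t2; rewrite !finset.inE => /asboolW[x Ax <-] /asboolW[y Ay <-].
by apply/asboolP; exists (x * y); [exact: subM|exact: qM].
Qed.

Lemma img_in (A : set G) x : is_subgroup A -> A x -> q x \in img A.
Proof. by move=> sA Ax; apply/imgP => //; exists x. Qed.

Lemma img_sub (A B : set G) : A `<=` B -> img A \subset img B.
Proof.
move=> AB; apply: genS; apply/fintype.subsetP => t; rewrite !finset.inE.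
by move=> /asboolW[x /AB Bx qx]; apply/asboolP; exists x.
Qed.

Lemma img_normal (A B : set G) : is_subgroup A -> is_subgroup B -> A `<=` B ->
  (forall x y, A x -> B y -> A (x ^ y)) -> img A <| img B.
Proof.
move=> sA sB AB nAB; rewrite /normal img_sub //; apply/normsP => _ /(imgP _ sB)[y By <-].
apply/eqP; rewrite finset.eqEcard cardJg leqnn andbT.
apply/fintype.subsetP => _ /imsetP[_ /(imgP _ sA)[x Ax <-] ->].
have -> : q x ^ q y = q (x ^ y) by rewrite !conjgE !qM morphVq.
by apply: img_in => //; exact: nAB.
Qed.

End Images.

(** * Growth of multiplicities *)

Section Growth.
Variables (G : starGroupType) (U : set G) (S : finGroupType).
Hypotheses (cG : compact [set: G]) (hG : hausdorff_space G).
Hypotheses (sU : is_subgroup U) (nU : is_normal U) (U1 : nbhs 1 U).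
Hypothesis expU : forall x : G, (forall i, U (sigma_pow i x)) -> x = 1.

Let cU : closed U. Proof. exact: closed_subgroup. Qed.
Let sV P : is_subgroup (vset U P). Proof. exact: vset_subgroup. Qed.
Let nV P : is_normal (vset U P). Proof. exact: vset_normal. Qed.
Let cV P : closed (vset U P). Proof. exact: vset_closed. Qed.

Let V (n : nat) := vset U (fun i => (0 <= i < n%:Z)%R).

Definition quotient_by (A : set G) (F : finGroupType) (q : G -> F) :=
  {morph q : x y / x * y} /\ (forall x y, q x = q y <-> A (x^-1 * y)).

(** The multiplicity of [S] in the image of [A] in [G / V n] is [c * n] up to a bounded error. All
    models [q] of this quotient are allowed, so none has to be chosen. *)
Definition growth (A : set G) (c : nat) := exists C : nat,
  forall n (F : finGroupType) (q : G -> F), quotient_by (V n) q ->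
    (mult S (img q A) <= c * n + C)%N /\ (c * n <= mult S (img q A) + C)%N.

Lemma growth_uniq A c d : growth A c -> growth A d -> c = d.
Proof.
suff key c' d' : growth A c' -> growth A d' -> (c' <= d')%N.
  by move=> gc gd; apply/eqP; rewrite eqn_leq !key.
(* This [n] exceeds the combined errors, so distinct rates would be told apart. *)
move=> [C cC] [D dD]; pose n := (C + D).+1.
have V1 : nbhs 1 (V n) by exact: vset_nbhs.
have [F [q [qM qV _]]] := open_quotient cG (sV _) (@nV _) V1.
have [_ lo] := cC n F q (conj qM qV).
have [hi _] := dD n F q (conj qM qV).
have : (c' * n <= d' * n + (C + D))%N by lia.
move=> le; rewrite leqNgt; apply/negP => dc.
by have := leq_mul dc (leqnn n); rewrite mulSn; lia.
Qed.

Lemma mult1 (F : finGroupType) (K : {group F}) : K :=: 1%g -> mult S K = 0%N.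
Proof.
move=> K1; rewrite (@mult_comps S F K [::]) //.
by rewrite /comps /= andbT; apply/eqP/val_inj.
Qed.

Lemma growth_one : growth [set 1] 0.
Proof.
exists 0%N => n F q [qM qV]; rewrite mul0n mult1 //.
have s1 : is_subgroup [set (1 : G)].
  by split=> [//|x y -> ->|x ->]; rewrite /= ?mulg1 ?invg1.
apply/trivgP/fintype.subsetP => t /(imgP qM _ s1)[x -> <-].
by rewrite (morph1q qM) finset.inE.
Qed.

(** The index of the image of [N] is at most [size s], so passing to [G] adds a bounded number of
    factors. *)
Lemma growth_finite N c (s : seq G) : is_subgroup N -> is_normal N ->
  (forall x, exists2 y, y \in s & N (y^-1 * x)) ->
  growth N c -> growth setT c.
Proof.
move=> sN nN sP [C CP]; exists (C + size s)%N => n F q qq.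
have [hi lo] := CP n F q qq; have [qM qV] := qq.
have sT : is_subgroup [set: G] by exact: subgroupT.
have nImg : img q N <| img q setT.
  by apply: img_normal => // x y Nx _; exact: nN.
have /andP[b1 b2] := mult_bounds S nImg.
suff idx : (#|img q setT : img q N| <= size s)%N.
  split; first by apply: leq_trans b2 _; rewrite addnA leq_add.
  by apply: leq_trans lo _; rewrite addnA -[X in (X <= _)%N]addn0 !leq_add.
apply: leq_trans (_ : #|[seq (img q N :* q y)%g | y <- s]| <= _)%N; last first.
  by apply: leq_trans (card_size _) _; rewrite size_map.
apply/subset_leq_card/fintype.subsetP => A /rcosetsP[_ /(imgP qM _ sT)[x _ <-] ->].
have [y ys Nyx] := sP x; apply/mapP; exists y => //.
apply/rcoset_eqP/rcosetP; exists (q (x * y^-1)); last by rewrite -qM mulgVK.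
apply: (img_in qM) => //.
by have := normal_conjV y nN Nyx; gsimp.
Qed.

(** Modulo [N], the coordinates in an interval and the symbols in [T] there determine each other, up
    to margins [a] and [b] independent of the interval. *)
Lemma growth_factor H N (T : finGroupType) c : is_star_subgroup H ->
  is_star_subgroup N -> N `<=` H -> simple [set: T]%SET -> shift_factor H N T ->
  growth N c -> growth H (c + ([set: S]%SET \isog [set: T]%SET)).
Proof.
move=> HH NN NH sT [f [fM fS fK fsurj [O O1 fO]]] [C0 C0P].
have [cH sH iH] := HH; have [cN sN _] := NN.
have f1 i : f 1 i = 1.
  by apply: (mulgI (f 1 i)); rewrite -fM ?mulg1 //; exact: sub1.
have fV x i : H x -> f x^-1 i = (f x i)^-1.
  move=> Hx; apply: (mulgI (f x i)); rewrite -fM ?mulgV ?f1 //; exact: subV.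
have fP k x i : H x -> f (sigma_pow k x) i = f x (i + k)%R.
  move=> Hx; rewrite (shift_factor_pow N HH fS) ?sigma_powD //; last exact: star_sub_powI.
  by rewrite -sigma_powD -(shift_factor_pow N HH fS).
(* By compactness the symbol at [0] depends only on the coordinates within distance [b]. *)
have [b bP] : exists b : nat, forall x, H x ->
    vset U (fun i => (- b%:Z <= i < b%:Z)%R) x -> f x 0%R = 1.
  move: O1; rewrite nbhsE => -[O' [oO' O'1] O'O].
  have [n|m n mn x [Hx Vx]|||b bP] := @compact_chain_sub G cG
    (fun n => H `&` vset U (fun i => (- n%:Z <= i < n%:Z)%R)) O'.
  - exact: closedI.
  - by split=> //; apply: vset_sub Vx => i; lia.
  - by [].
  - move=> x xP; suff -> : x = 1 by [].
    by apply: expU => i; apply: (xP `|i|.+1).2; lia.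
  by exists b => x Hx Vx; apply: fO => //; apply/O'O/bP.
have [k kP] := gluing_interval cG sU nU U1 NN.
(* Conversely, the symbols within distance [a] determine the first [k] coordinates modulo [N]. *)
have [a aP] : exists a : nat, forall x, H x ->
    (forall i : int, (- a%:Z <= i < a%:Z)%R -> f x i = 1) -> setmul (V k) N x.
  pose Z n : set G := H `&` [set x | forall i : int, (- n%:Z <= i < n%:Z)%R -> f x i = 1].
  have sZ n : is_subgroup (Z n).
    split; first by split=> [|i _]; [exact: sub1|exact: f1].
      move=> x y [Hx fx] [Hy fy]; split=> [|i ii]; first exact: subM.
      by rewrite fM // fx // fy // mulg1.
    by move=> x [Hx fx]; split=> [|i ii]; [exact: subV|rewrite fV // fx // invg1].
  have sVN : is_subgroup (setmul (V k) N) by exact: (setmul_subgroup (sV _) sN (@nV _)).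
  have [n|m n mn x [Hx fx]|||a aP] := @compact_chain_sub G cG Z (setmul (V k) N).
  - apply: (closed_of_open_in (sZ n) sH cH) => [x []//|].
    exists [set x | forall i : int, (- n%:Z <= i < n%:Z)%R -> O (sigma_pow i x)].
      exact: (@vset_nbhs G O (- n%:Z)%R n%:Z O1).
    move=> x Hx Ox; split=> // i ii; rewrite (shift_factor_pow N HH fS) //.
    by apply: fO; [exact: star_sub_powI|exact: Ox].
  - by split=> // i ii; apply: fx; lia.
  - apply: open_subgroup => //; apply: filterS (setmul_subl sN) _.
    exact: vset_nbhs.
  - move=> x xP; apply: (setmul_subr (sV _)); apply/(fK x (xP 0%N).1) => i.
    by apply: (xP `|i|.+1).2; lia.
  by exists a => x Hx fx; apply: aP.
pose d : nat := [set: S]%SET \isog [set: T]%SET.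
(* There are [n + a + a] steps from [H] down to [N], and all but at most [a + a + b + b] of them are
   certainly proper. *)
exists (C0 + a + a + b + b)%N => n F q qq; have [qM qV] := qq.
have [hi0 lo0] := C0P n F q qq.
have q1 x : V n x -> q x = 1.
  by move=> Vx; rewrite -(morph1q qM); apply/esym/qV; rewrite invg1 mul1g.
(* The images of the [Hj j] descend from that of [H] to that of [N]; each factor
   is trivial or [T], and it can be trivial only near the two ends. *)
pose Hj (j : nat) : set G := H `&`
  [set x | forall i : int, (- a%:Z <= i < j%:Z - a%:Z)%R -> f x i = 1].
have sHj j : is_subgroup (Hj j).
  split; first by split=> [|i _]; [exact: sub1|exact: f1].
    move=> x y [Hx fx] [Hy fy]; split=> [|i ii]; first exact: subM.
    by rewrite fM // fx // fy // mulg1.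
  by move=> x [Hx fx]; split=> [|i ii]; [exact: subV|rewrite fV // fx // invg1].
have decH j : Hj j.+1 `<=` Hj j.
  by move=> x [Hx fx]; split=> // i ii; apply: fx; lia.
have nHj j x y : Hj j.+1 x -> Hj j y -> Hj j.+1 (x ^ y).
  move=> [Hx fx] [Hy _]; split=> [|i ii].
    by rewrite conjgE; apply: subM => //; [exact: subV|exact: subM].
  rewrite conjgE !fM ?fV //; do ?[exact: subV|exact: subM].
  by rewrite fx // mul1g mulVg.
have hP j t : exists x, Hj j x /\ f x (j%:Z - a%:Z)%R = t.
  have [x Hx fx] := fsurj (fun i => if i == (j%:Z - a%:Z)%R then t else 1).
  exists x; rewrite fx eqxx; split=> //; split=> // i ii; rewrite fx ifF //.
  by apply/eqP => ij; move: ii; rewrite ij; lia.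
pose h j t := q (projT1 (cid (hP j t))).
have hE j t : exists x, [/\ Hj j x, f x (j%:Z - a%:Z)%R = t & h j t = q x].
  by rewrite /h; case: cid => x [Hx fx]; exists x.
have inHj j x : Hj j x -> f x (j%:Z - a%:Z)%R = 1 -> Hj j.+1 x.
  move=> [Hx fx] fxj; split=> // i ii.
  have [->//|ij] := eqVneq i (j%:Z - a%:Z)%R.
  by apply: fx; lia.
have step j : mult S (img q (Hj j)) = (mult S (img q (Hj j.+1)) +
    ((img q (Hj j.+1) != img q (Hj j)) && ([set: S]%SET \isog [set: T]%SET)))%N.
  apply: (@mult_step S _ _ _ _ (h j)) => //.
  - by apply: img_normal => //; exact: nHj.
  - by move=> t; have [x [Hx _ ->]] := hE j t; exact: img_in.
  - move=> t u; have [x [Hx fx ->]] := hE j (t * u).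
    have [y [Hy fy ->]] := hE j t; have [z [Hz fz ->]] := hE j u.
    rewrite -(morphVq qM) -!qM; apply: (img_in qM) => //.
    have [[Hx0 _] [Hy0 _] [Hz0 _]] := And3 Hx Hy Hz.
    apply: inHj; first by apply: (subVM (sHj _)) => //; exact: (subM (sHj _)).
    by rewrite !fM ?fV ?fx ?fy ?fz ?mulVg //; do ?[exact: subV|exact: subM].
  - move=> _ /(imgP qM _ (sHj j))[y Hy <-].
    exists (f y (j%:Z - a%:Z)%R).
    have [z [Hz fz ->]] := hE j (f y (j%:Z - a%:Z)%R).
    rewrite -(morphVq qM) -qM; apply: (img_in qM) => //.
    have [[Hy0 _] [Hz0 _]] := conj Hy Hz.
    apply: inHj; first exact: (subVM (sHj _)).
    by rewrite fM ?fV ?fz ?mulVg //; exact: subV.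
have [t _ t1] : exists2 t : T, t \in [set: T]%SET & t != 1.
  by apply/trivgPn; have /simpleP[] := sT.
(* For these [j] the places within [b] of [j - a] lie between [0] and [n], so the image in [G / V n]
   still sees the symbol at [j - a]. *)
have proper_step j : (a + b <= j)%N -> (j + b < n + a)%N ->
    img q (Hj j.+1) != img q (Hj j).
  move=> abj jbn; have [x [Hx fx]] := hP j t.
  apply/negP => /eqP e; have := img_in qM (sHj j) Hx.
  rewrite -e => /(imgP qM _ (sHj _))[y Hy /qV Vyx].
  have [[Hx0 _] [Hy0 fy]] := conj Hx Hy; have Hyx := subVM sH Hy0 Hx0.
  case/eqP: t1; rewrite -fx -[LHS]mul1g -[X in X * _]invg1.
  rewrite -[X in X^-1](fy (j%:Z - a%:Z)%R); last by lia.
  rewrite -fV // -fM //; last exact: subV.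
  rewrite -[(_ - _)%R]add0r -fP //; apply: bP; first exact: star_sub_powI.
  by apply: vset_shiftI Vyx => i; lia.
(* The truncated difference counts the steps before [j] known to be proper. *)
have main j : (mult S (img q (Hj j)) + d * (minn j (n + a - b) - (a + b)) <=
    mult S (img q (Hj 0%N)))%N /\
    (mult S (img q (Hj 0%N)) <= mult S (img q (Hj j)) + d * j)%N.
  elim: j => [|j [IH1 IH2]]; first by rewrite min0n sub0n !muln0 addn0.
  have := step j; have := proper_step j; move: IH1 IH2; rewrite /d.
  case: (_ \isog _) => /=; rewrite ?mul0n ?mul1n ?andbF; last by lia.
  by rewrite andbT; case: (_ != _) => /= ? ? ps ?; [lia|];
    have := fun h1 h2 => notF (ps h1 h2); lia.
have H0 : Hj 0%N = H.
  by apply/seteqP; split=> [x []//|x Hx]; split=> // i; lia.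
(* Trivial symbols from [- a] to [n + a] give triviality modulo [N] on [n] consecutive windows;
   gluing them gives a factor in [V n], invisible to [q]. *)
have HJ : img q (Hj (n + a + a)%N) = img q N.
  apply/val_inj/eqP; rewrite finset.eqEsubset; apply/andP; split; last first.
    apply: img_sub => x Nx; split; first exact: NH.
    by move=> i _; apply: (fK x (NH _ Nx)).1.
  apply/fintype.subsetP => _ /(imgP qM _ (sHj _))[x [Hx fx] <-].
  have [|v Vv Nv] := kP 0%R n x.
    move=> i ni; apply: aP; first exact: star_sub_powI.
    by move=> l la; rewrite fP //; apply: fx; lia.
  have -> : q x = q (v^-1 * x).
    by rewrite -[in LHS](mulVKg v x) qM q1 ?mul1g //.
  exact: (img_in qM sN Nv).
have [m1 m2] := main (n + a + a)%N.
move: m1 m2; rewrite H0 HJ => m1 m2; rewrite mulnDl -/d.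
have {}m1 : (mult S (img q N) + d * n <= mult S (img q H) + a + a + b + b)%N.
  by move: m1; rewrite /d; case: (_ \isog _); lia.
have {}m2 : (mult S (img q H) <= mult S (img q N) + d * n + a + a)%N.
  by move: m2; rewrite /d; case: (_ \isog _); lia.
by split; lia.
Qed.

End Growth.

(** * The theorem *)

Section Series.
Variable G : starGroupType.

Lemma expansive_subgroup : expansive_profinite G ->
  exists U : set G, [/\ is_subgroup U, is_normal U, nbhs 1 U
    & forall x : G, (forall i, U (sigma_pow i x)) -> x = 1].
Proof.
move=> [[cG hG dG] [A A1 capA]].
have [U [sU nU U1 UA]] := open_normal_subgroup cG hG dG A1.
exists U; split=> // x Ux.
suff : (\bigcap_(n : int) (sigma_pow n @` A)) x by rewrite capA.
move=> n _; exists (sigma_pow (- n)%R x); last exact: sigma_powNK.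
exact/UA/Ux.
Qed.

Lemma series_of_tower (G1 : set G) : compact [set: G] -> is_star_subgroup G1 ->
  is_normal G1 -> nbhs 1 G1 -> tower G1 [set 1] ->
  exists (n : nat) (Gs : nat -> starSubgroup G) (Sg : nat -> finGroupType),
    shift_series n Gs Sg.
Proof.
move=> cG GG nG1 G1n [r [Gs [Sg [G0 Gr Gstar GS]]]].
pose Hs i := projT1 (cid (starSubgroup_of (Gstar i))).
have HsE i : (Hs i : set G) = Gs i by rewrite /Hs; case: cid.
(* A series is indexed from [1] and a tower from [0], hence [i.-1] and one more term than there are
   factors. *)
exists r.+1, (fun i => Hs i.-1), (fun i => Sg i.-1); split=> //=.
- have nN : normal_subgroup (Hs 0%N) by move=> x y; rewrite HsE G0; exact: nG1.
  exists nN; have [_ sG1 _] := GG; have [s sP] := finite_index cG sG1 G1n.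
  apply: (@sub_finite_set _ _ [set` [seq \pi_(Defs.quotient_group nN)%qT y | y <- s]]).
    elim/quo_ind=> x _; have [y ys Gyx] := sP x.
    apply/mapP; exists y => //; apply/esym/(Defs.cosetP nN)/coset_relP.
    by rewrite HsE G0.
  exact: finite_seq.
- move=> [|i] //= ir; have [Gii sS fS] := GS i ir.
  split=> //; first by rewrite !HsE.
  by apply: isom_of_shift_factor; rewrite // !HsE.
- by rewrite HsE.
Qed.

Variable U : set G.
Hypotheses (cG : compact [set: G]) (hG : hausdorff_space G).
Hypotheses (sU : is_subgroup U) (nU : is_normal U) (U1 : nbhs 1 U).
Hypothesis expU : forall x : G, (forall i, U (sigma_pow i x)) -> x = 1.

Lemma growth_chain (S : finGroupType) (m : nat) (Gs : nat -> set G)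
    (Sg : nat -> finGroupType) :
  (forall i, is_star_subgroup (Gs i)) ->
  (forall i, (i < m)%N -> [/\ Gs i.+1 `<=` Gs i, simple [set: Sg i]%SET
     & shift_factor (Gs i) (Gs i.+1) (Sg i)]) ->
  growth U S (Gs m) 0 ->
  growth U S (Gs 0%N) (\sum_(i < m) ([set: S]%SET \isog [set: Sg i]%SET))%N.
Proof.
elim: m Gs Sg => [|m IH] Gs Sg Gstar GS gm; first by rewrite big_ord0.
have [G10 sS fS] := GS 0%N isT.
rewrite big_ord_recl addnC.
apply: (growth_factor cG sU nU U1 expU (Gstar 0%N) (Gstar 1%N) G10 sS fS).
by apply: (IH (fun i => Gs i.+1) (fun i => Sg i.+1)) => // i im; exact: (GS i.+1 im).
Qed.

Lemma growth_series (S : finGroupType) (n : nat) (Gs : nat -> starSubgroup G)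
    (Sg : nat -> finGroupType) : shift_series n Gs Sg ->
  growth U S setT (\sum_(i < n.-1) ([set: S]%SET \isog [set: Sg i.+1]%SET))%N.
Proof.
case: n => [|n] [// _ [nG1 /finite_seqP[s sE]] GS Gn].
have sN1 := starSubgroup_star (Gs 1%N); have [_ sG1 _] := sN1.
apply: (@growth_finite _ U S (Gs 1%N : set G) _ [seq generic_quotient.repr y | y <- s]) => //.
  move=> x; have : \pi_(Defs.quotient_group nG1)%qT x \in s.
    have : [set: Defs.quotient_group nG1] (\pi_(Defs.quotient_group nG1)%qT x) by [].
    by rewrite sE.
  move=> xs; exists (generic_quotient.repr (\pi_(Defs.quotient_group nG1)%qT x)).
    exact: map_f.
  by apply/coset_relP/(Defs.cosetP nG1); rewrite reprK.
apply: (@growth_chain S n (fun i => Gs i.+1 : set G) (fun i => Sg i.+1)).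
- by move=> i; exact: starSubgroup_star.
- move=> i im; have [|Gii sS [nGi iso]] := GS i.+1; first by rewrite ltnS.
  by split=> //; exact: shift_factor_of_isom iso.
- by rewrite Gn; exact: growth_one.
Qed.

End Series.

Theorem theorem6p13 (G : starGroupType) (hG : expansive_profinite G) :
  (exists (n : nat) (Gs : nat -> starSubgroup G) (Sg : nat -> finGroupType),
     shift_series n Gs Sg) /\
  (forall (n n' : nat) (Gs Gs' : nat -> starSubgroup G)
          (Sg Sg' : nat -> finGroupType),
     shift_series n Gs Sg -> shift_series n' Gs' Sg' ->
     n = n' /\
     exists s : {perm 'I_n.-1}, forall i : 'I_n.-1,
       [set: Sg i.+1]%SET \isog [set: Sg' (s i).+1]%SET).
Proof.
have [U [sU nU U1 expU]] := expansive_subgroup hG.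
have [[cG hsG _] _] := hG.
split.
  have [G1 [GG nG1 G1n tG]] := tower_exists cG hsG sU nU U1 expU.
  exact: series_of_tower tG.
move=> n n' Gs Gs' Sg Sg' sn sn'.
have [|nn' [s sP]] := @perm_of_counts n.-1 n'.-1 (fun i => Sg i.+1) (fun i => Sg' i.+1).
  move=> S; have g := growth_series cG sU nU U1 expU S sn.
  have g' := growth_series cG sU nU U1 expU S sn'.
  exact: growth_uniq g g'.
split; last by exists s.
(* Both lengths are positive, so equal predecessors give equal lengths. *)
by move: nn'; have [n0 _ _ _] := sn; have [n0' _ _ _] := sn'; lia.
Qed.
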